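(* Let $I\subset\mathbb{R}$ be a finite interval with $|I|=1$, let $k:I\times I\to\mathbb{R}$ be Borel measurable with $k_0\le k(\xi,\eta)\le k_1$ for all $\xi,\eta\in I$, where $0<k_0<k_1$ are constants. Let $F\in C(\mathbb{T}^d\times\mathbb{R}^d)\otimes\mathcal{B}(I)$ and $f\in C(\mathbb{T}^d)\otimes\mathcal{B}(I)$, with $f$ bounded on $\mathbb{T}^d\times I$ and $F(\cdot,p,\cdot)$ bounded on $\mathbb{T}^d\times I$ for each $p\in\mathbb{R}^d$, and suppose that assumptions (A1)–(A5) hold. For $\alpha>0$ let $v^\alpha\in C(\mathbb{T}^d)\otimes\mathcal{B}(I)$ be the (unique) viscosity solution of $$\alpha v^\alpha(x,\xi)+F(x,Dv^\alpha(x,\xi),\xi)+\int_I k(\xi,\eta)\big(v^\alpha(x,\xi)-v^\alpha(x,\eta)\big)\,d\eta=f(x,\xi)\quad\text{in }\mathbb{T}^d\times I.$$ Then there exists $v\in C(\mathbb{T}^d)\otimes\mathcal{B}(I)$ which is a viscosity solution of $$F(x,Dv(x,\xi),\xi)+\int_I k(\xi,\eta)\big(v(x,\xi)-v(x,\eta)\big)\,d\eta=f(x,\xi)\quad\text{in }\mathbb{T}^d\times I,$$ such that for every $\xi\in I$, $v^\alpha(\cdot,\xi)\to v(\cdot,\xi)$ uniformly on $\mathbb{T}^d$ as $\alpha\to0$.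
   Context: $\mathbb{T}^d$ is the flat $d$-dimensional torus; $|\cdot|$ is Lebesgue measure. $\mathcal{B}(I)$ is the space of Borel functions on $I$. $C(\mathbb{T}^d)\otimes\mathcal{B}(I)$ denotes the set of functions $g$ on $\mathbb{T}^d\times I$ such that $g(x,\cdot)$ is Borel measurable for each $x$ and $g(\cdot,\xi)$ is continuous for each $\xi$; similarly $C(\mathbb{T}^d\times\mathbb{R}^d)\otimes\mathcal{B}(I)$ (continuous in $(x,p)$ for each $\xi$, Borel in $\xi$ for each $(x,p)$). $\mathcal{U}^+(\mathbb{T}^d\times I)$ is the set of functions $u$ on $\mathbb{T}^d\times I$ such that for all $x$, $u(x,\cdot)$ is Borel measurable and integrable on $I$ (with respect to the kernel $k$), and for each $\xi$, $u(\cdot,\xi)$ is upper semicontinuous; $\mathcal{U}^-:=-\mathcal{U}^+$. For an equation of the form $\alpha u+G(x,Du,\xi)+\int_I k(\xi,\eta)(u(x,\xi)-u(x,\eta))d\eta=0$ (with $\alpha\ge0$), $u\in\mathcal{U}^+$ is a viscosity subsolution if whenever $\phi\in C^1(\mathbb{T}^d)$, $\xi\in I$ and $u(\cdot,\xi)-\phi$ has a local maximum at $\hat x$, then $\alpha u(\hat x,\xi)+G(\hat x,D\phi(\hat x),\xi)+\int_I k(\xi,\eta)(u(\hat x,\xi)-u(\hat x,\eta))d\eta\le0$; supersolutions ($u\in\mathcal{U}^-$, local minima, $\ge0$) are defined symmetrically, and a solution is both (lying in $\mathcal{U}^+\cap\mathcal{U}^-$). Assumptions: (A1) there are constants $C_1,C_2>0$,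 $m>1$ with $C_1|p|^m-C_2\le F(x,p,\xi)$ for all $(x,p,\xi)$. (A2) $f\ge0$ and $\mathcal{A}:=\{x\in\mathbb{T}^d: f(x,\xi)=0\ \text{for all }\xi\in I\}\neq\emptyset$. (A3) $p\mapsto F(x,p,\xi)$ is convex for each $(x,\xi)$. (A4) $F\ge0$ and $F(x,0,\xi)=0$ for all $(x,\xi)$. (A5) there is a modulus of continuity $\omega$ with $|f(x,\xi)-f(y,\xi)|\le\omega(|x-y|)$ for all $x,y,\xi$, and for each $R>0$ a modulus $\omega_R$ with $|F(x,p,\xi)-F(y,q,\xi)|\le\omega_R(|x-y|+|p-q|)$ for all $x,y\in\mathbb{T}^d$, $p,q\in B(0,R)$, $\xi\in I$. *)

(* Defs.v *)
From HB Require Import structures.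
From mathcomp Require Import all_boot all_order all_algebra.
From mathcomp Require Import all_classical all_reals all_analysis.
Set Implicit Arguments. Unset Strict Implicit. Unset Printing Implicit Defensive.
Import Order.TTheory GRing.Theory Num.Theory.
Import numFieldNormedType.Exports.
Local Open Scope classical_set_scope.
Local Open Scope ring_scope.

Section Defs.
Context {R : realType} {d : nat}.
Notation V := 'rV[R]_d.

(* functions on the flat torus T^d = R^d / Z^d are represented by their
   Z^d-periodic lifts to R^d *)
Definition periodic {T : Type} (g : V -> T) :=
  forall (x : V) (j : 'I_d), g (x + delta_mx 0 j) = g x.

Definition usc (g : V -> R) :=
  forall x (e : R), 0 < e -> \forall y \near x, g y < g x + e.

Definition grad (phi : V -> R) (x : V) : V :=
  \row_(j < d) ('d phi x) (delta_mx 0 j : V).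

Definition C1 (phi : V -> R) :=
  (forall x, differentiable phi x) /\ continuous (grad phi).

Definition Iset (I : interval R) : set R := [set` I].

Definition borel_integrable (I : interval R) (u : V -> R -> R) :=
  forall x, measurable_fun (Iset I) (u x) /\
            (@lebesgue_measure R).-integrable (Iset I) (EFin \o u x).

Definition Uplus (I : interval R) (u : V -> R -> R) :=
  borel_integrable I u /\ (forall xi, periodic (u ^~ xi)) /\
  (forall xi, xi \in I -> usc (u ^~ xi)).

Definition Uminus (I : interval R) (u : V -> R -> R) :=
  Uplus I (fun x xi => - u x xi).

Definition coupling (I : interval R) (k : R -> R -> R) (u : V -> R -> R)
  (x : V) (xi : R) : R :=
  \int[@lebesgue_measure R]_(eta in Iset I) (k xi eta * (u x xi - u x eta)).

Definition visc_sub (I : interval R) (k : R -> R -> R) (alpha : R)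
  (F : V -> V -> R -> R) (f : V -> R -> R) (u : V -> R -> R) :=
  Uplus I u /\
  forall (phi : V -> R) (xi : R) (xh : V), C1 phi -> xi \in I ->
    (\forall y \near xh, u y xi - phi y <= u xh xi - phi xh) ->
    alpha * u xh xi + F xh (grad phi xh) xi + coupling I k u xh xi
      <= f xh xi.

Definition visc_super (I : interval R) (k : R -> R -> R) (alpha : R)
  (F : V -> V -> R -> R) (f : V -> R -> R) (u : V -> R -> R) :=
  Uminus I u /\
  forall (phi : V -> R) (xi : R) (xh : V), C1 phi -> xi \in I ->
    (\forall y \near xh, u y xi - phi y >= u xh xi - phi xh) ->
    alpha * u xh xi + F xh (grad phi xh) xi + coupling I k u xh xi
      >= f xh xi.

Definition visc_sol I k alpha F f u :=
  visc_sub I k alpha F f u /\ visc_super I k alpha F f u.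

Definition CB (I : interval R) (u : V -> R -> R) :=
  (forall xi, periodic (u ^~ xi) /\ continuous (u ^~ xi)) /\
  (forall x, measurable_fun (Iset I) (u x)).

Definition CB2 (I : interval R) (F : V -> V -> R -> R) :=
  (forall xi, continuous (fun xp : V * V => F xp.1 xp.2 xi) /\
              forall p, periodic (fun x => F x p xi)) /\
  (forall x p, measurable_fun (Iset I) (F x p)).

Definition modulus (w : R -> R) :=
  w 0 = 0 /\ (forall r, 0 <= r -> 0 <= w r) /\
  {in `[0, +oo[ &, {homo w : r s / r <= s}} /\
  w r @[r --> 0^'+] --> 0.

End Defs.

(* Main.v *)
(* The limit is a monotone one: [v^alpha >= 0] is a supersolution of the problem
   with any larger discount, so by comparison [v^alpha] increases as [alpha]
   decreases to 0.  It remains to bound [v^alpha] and its Lipschitz constant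
   uniformly in [alpha] and to invoke the stability of viscosity solutions.

   Since [F >= 0] and touching points are dense, a solution [v] satisfies
   [alpha v + int k(xi,eta) (v(x,xi) - v(x,eta)) d eta <= f] pointwise.  Where
   [f] vanishes this forces [v <= 0].  Maximizing [v(x,xi) - phi(x)] over both
   variables, for a cone [phi] centred at a zero of [f], makes the coupling term
   bounded below by [-k1], so coercivity confines the maximum to the vertex and
   [v] is bounded independently of [alpha]; the same cones then give the
   Lipschitz bound.

   The definition of solution does not make [v] bounded, nor
   [x |-> int k(xi,eta) v(x,eta) d eta] continuous.  However
   [P : x |-> int v^+(x,eta) d eta] is lower semicontinuous by Fatou's lemma, so
   by Baire there is a dense set of [x] near which [P] exceeds [P(x)] by at most
   a constant.  There the pointwise inequality holds up to a constant, for all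
   [xi] at once, which bounds [v] from above; lower semicontinuity of
   [x |-> int v^-(x,eta) d eta] and the equation at minima bound it below. *)
Require Import Defs.
From HB Require Import structures.
From mathcomp Require Import all_boot all_order all_algebra.
From mathcomp Require Import all_classical all_reals all_analysis.
From mathcomp Require Import ring lra.
Import Order.TTheory GRing.Theory Num.Theory.
Import numFieldNormedType.Exports.
Local Open Scope classical_set_scope.
Local Open Scope ring_scope.
Set Implicit Arguments. Unset Strict Implicit. Unset Printing Implicit Defensive.

(** * Integrals *)

Section Integrals.
Context (dsp : measure_display) (T : measurableType dsp) (R : realType).
Variables (mu : {measure set T -> \bar R}) (D : set T).
Hypothesis mD : measurable D.

Lemma integrableM_bounded (h g : T -> R) (c : R) :
  measurable_fun D h -> (forall x, D x -> `|h x| <= c) ->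
  mu.-integrable D (EFin \o g) ->
  mu.-integrable D (EFin \o (fun x => h x * g x)).
Proof.
move=> mh hc ig.
have := integrableMr mD mh _ ig; apply.
exists c; split; first exact: num_real.
by move=> e ce x Dx; apply: le_trans (hc x Dx) (ltW ce).
Qed.

Lemma integrable_bounded (g : T -> R) (c : R) :
  (mu D < +oo)%E -> measurable_fun D g -> (forall x, D x -> `|g x| <= c) ->
  mu.-integrable D (EFin \o g).
Proof.
move=> fD mg gc; apply: measurable_bounded_integrable => //.
exists c; split; first exact: num_real.
by move=> e ce x Dx; apply: le_trans (gc x Dx) (ltW ce).
Qed.

(** If this failed along points [y n] tending to [x], Fatou's lemma for that sequence would
    contradict the gap [e]. Nonnegativity takes the place of a dominating function. *)
Lemma integral_lsc (V : pseudoMetricNormedZmodType R) (g : V -> T -> R) (x : V)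
    (e : R) :
  (forall y, mu.-integrable D (EFin \o g y)) ->
  (forall y t, D t -> 0 <= g y t) ->
  (forall t, D t -> {for x, continuous (g ^~ t)}) -> 0 < e ->
  \forall y \near x,
    \int[mu]_(t in D) g x t - e < \int[mu]_(t in D) g y t.
Proof.
move=> ig g0 cg e0; apply: contrapT => nP.
have {nP} H n : exists y, `|x - y| < n.+1%:R^-1 /\
    \int[mu]_(t in D) g y t <= \int[mu]_(t in D) g x t - e.
  apply: contrapT => /forallNP H; apply: nP.
  apply/nbhs_normP; exists n.+1%:R^-1; first by rewrite /= invr_gt0.
  by move=> y /= xy; rewrite ltNge; apply/negP => le; apply: (H y).
move: H => /choice[y H].
have yx : y n @[n --> \oo] --> x.
  apply/cvgrPdist_lt => r r0; near=> n.
  apply: lt_trans (proj1 (H n)) _.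
  near: n; exact: near_infty_natSinv_lt (PosNum r0).
have ifin z : (\int[mu]_(t in D) (g z t)%:E)%E \is a fin_num
  by exact: (integrable_fin_num mD (ig z)).
have intE z : ((\int[mu]_(t in D) g z t)%:E = \int[mu]_(t in D) (g z t)%:E)%E.
  by rewrite /Rintegral fineK.
have := @fatou _ _ _ mu D mD (fun n t => (g (y n) t)%:E).
move=> /(_ (fun n => measurable_int _ (ig (y n)))).
move=> /(_ (fun n t Dt => g0 (y n) t Dt)).
rewrite (_ : (\int[mu]_(t in D) _)%E = (\int[mu]_(t in D) g x t)%:E); last first.
  rewrite intE; apply: eq_integral => t /set_mem Dt.
  have gc : (g (y n) t)%:E @[n --> \oo] --> (g x t)%:E.
    apply/cvg_EFin; first by near=> n.
    exact: (cvg_comp y (g^~ t) yx (cg t Dt)).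
  by case: (cvg_limn_einf_sup gc).
apply/negP; rewrite -ltNge.
rewrite (@le_lt_trans _ _ (\int[mu]_(t in D) g x t - e)%:E)//; last first.
  by rewrite lte_fin ltrBlDr ltrDl.
rewrite limn_einf_lim; apply: lime_le; first exact: is_cvg_einfs.
near=> n; apply: (@le_trans _ _ (\int[mu]_(t in D) (g (y n) t)%:E)%E).
  by apply: ereal_inf_lbound; exists n => /=.
by rewrite -intE lee_fin; case: (H n).
Unshelve. all: by end_near. Qed.

Lemma Rintegral_bounded_cvg (g : nat -> T -> R) (h : T -> R) (c : R) :
  (mu D < +oo)%E ->
  (forall n, measurable_fun D (g n)) ->
  (forall n t, D t -> `|g n t| <= c) ->
  (forall t, D t -> g n t @[n --> \oo] --> h t) ->
  \int[mu]_(t in D) g n t @[n --> \oo] --> \int[mu]_(t in D) h t.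
Proof.
move=> fD mg gc gh.
have mh : measurable_fun D h by exact: measurable_realfun.measurable_fun_cvg gh.
have ic : mu.-integrable D (EFin \o cst c).
  apply: (@integrable_bounded _ `|c|) => //.
have := @dominated_convergence _ _ _ mu D mD (fun n => EFin \o g n) (EFin \o h) (EFin \o cst c).
case.
- by move=> n; apply/measurable_realfun.measurable_EFinP.
- exact/measurable_realfun.measurable_EFinP.
- apply: aeW => t Dt; apply/cvg_EFin; first by near=> n.
  exact: gh.
- exact: ic.
- by apply: aeW => t n Dt /=; rewrite lee_fin gc.
move=> ih _ H; apply: fine_cvg.
by rewrite fineK ?(integrable_fin_num mD ih).
Unshelve. all: by end_near. Qed.

End Integrals.

(** * Test functions *)

Section TestFunctions.
Context {R : realType} {d : nat}.
Notation V := 'rV[R]_d.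
Implicit Types (x y a : V) (h : R -> R) (phi psi : V -> R).

Lemma coord_le_norm x j : `|x 0 j| <= `|x|.
Proof.
rewrite [leRHS]/Num.norm /= mx_normrE.
by apply/bigmax_geP; right => /=; exists (0, j).
Qed.

Lemma norm_rV_lt x (e : R) : 0 < e -> (forall j, `|x 0 j| < e) -> `|x| < e.
Proof.
move=> e0 xe; rewrite [ltLHS]/Num.norm /= mx_normrE.
by apply/bigmax_ltP; split => //= -[i j] _ /=; rewrite ord1.
Qed.

(** The norm is the maximum norm, attained at some coordinate; [0 < e] excludes the empty maximum of
    dimension 0. *)
Lemma norm_rV_exists x (e : R) : 0 < e -> e <= `|x| -> exists j, e <= `|x 0 j|.
Proof.
move=> e0 ex; apply: contrapT => /forallNP H.
suff : `|x| < e by rewrite ltNge ex.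
by apply: norm_rV_lt => // j; rewrite ltNge; apply/negP.
Qed.

Lemma continuous_row (U : topologicalType) (g : 'I_d -> U -> R) :
  (forall j, continuous (g j)) -> continuous (fun u => \row_j g j u : V).
Proof.
move=> cg x; apply/cvgrPdist_lt => e e0.
have : \forall y \near x, forall j, `|g j x - g j y| < e.
  by apply: filter_forall => j; have /cvgrPdist_lt := cg j x; apply.
by apply: filterS => y H; apply: norm_rV_lt => // j; rewrite !mxE.
Qed.

(** The maximum norm is not differentiable, so test functions are built by summing one smooth
    profile [h] over the coordinates of [x - a], which makes their gradients explicit. *)
Definition sepfun h a x : R := \sum_(j < d) h (x 0 j - a 0 j).

Lemma gradE phi x (v : V) : (forall j, is_derive x (delta_mx 0 j : V) phi (v 0 j)) ->
  differentiable phi x -> grad phi x = v.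
Proof.
move=> H df; apply/rowP => j; rewrite mxE -deriveE//.
by apply: derive_val.
Qed.

Section Separable.
Variables (h h' : R -> R) (a : V).
Hypothesis dh : forall z : R, is_derive z (1 : R) h (h' z).

Let term j := fun x => h (x 0 j - a 0 j).

Let is_diff_term j x : is_diff x (term j) (fun v => v 0 j * h' (x 0 j - a 0 j)).
Proof.
have d1 : is_diff x (fun y : V => y 0 j) (fun y : V => y 0 j).
  apply: DiffDef; first exact: differentiable_coord.
  have @f : {linear V -> R}.
    by exists (fun N : V => N 0 j); do 2![eexists]; do ?[constructor];
     rewrite ?mxE// => ? *; rewrite ?mxE//; move=> ?; rewrite !mxE.
  rewrite (_ : (fun y : V => y 0 j) = f) // diff_lin//.
  exact: coord_continuous.
have d2 : is_diff (x 0 j) (fun z => h (z - a 0 j)) (fun u => u * h' (x 0 j - a 0 j)).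
  have dd : is_derive (x 0 j) 1 (fun z => h (z - a 0 j)) (h' (x 0 j - a 0 j)).
    apply: (@is_derive_eq _ _ _ _ _ _ _ _ (is_derive1_comp _ _)).
    by rewrite subr0 mulr1.
  have df : differentiable (fun z => h (z - a 0 j)) (x 0 j).
    by apply/derivable1_diffP; apply: ex_derive.
  apply: DiffDef => //; rewrite diff1E//; apply/funext => u.
  by rewrite derive1E derive_val.
exact: (is_diff_comp d1 d2).
Qed.

Lemma sepfun_differentiable x : differentiable (sepfun h a) x.
Proof.
rewrite (_ : sepfun h a = \sum_(j < d) term j); last first.
  by apply/funext => y; rewrite fct_sumE.
apply: differentiable_sum => j; have ? := is_diff_term j x; exact: ex_diff.
Qed.

Lemma grad_sepfun x : grad (sepfun h a) x = \row_j h' (x 0 j - a 0 j).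
Proof.
apply: gradE; last exact: sepfun_differentiable.
move=> j; rewrite mxE (_ : sepfun h a = \sum_(j < d) term j); last first.
  by apply/funext => y; rewrite fct_sumE.
apply: is_derive_eq.
  apply: (@is_derive_sum _ _ _ _ _ _ _ (fun i => (delta_mx 0 j : V) 0 i * h' (x 0 i - a 0 i))) => i.
  have dt := is_diff_term i x.
  apply: DeriveDef; first by apply: diff_derivable; exact: ex_diff.
  by rewrite deriveE ?diff_val//; exact: ex_diff.
rewrite (bigD1 j)//= big1 ?addr0; first by rewrite mxE !eqxx mul1r.
by move=> i ij; rewrite mxE (negbTE ij) andbF mul0r.
Qed.

Lemma C1_sepfun : continuous h' -> C1 (sepfun h a).
Proof.
move=> ch; split; first exact: sepfun_differentiable.
rewrite (_ : grad (sepfun h a) = fun x => \row_j h' (x 0 j - a 0 j)); last first.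
  by apply/funext => x; exact: grad_sepfun.
apply: continuous_row => j x.
apply: (@continuous_comp _ _ _ (fun x : V => x 0 j - a 0 j) h'); last exact: ch.
by apply: continuousB; [exact: coord_continuous | exact: cst_continuous].
Qed.

End Separable.

Lemma gradD phi psi x : differentiable phi x -> differentiable psi x ->
  grad (fun y => phi y + psi y) x = grad phi x + grad psi x.
Proof.
move=> dp dq; apply/rowP => j; rewrite !mxE.
by rewrite (diffD dp dq).
Qed.

Lemma C1D phi psi : C1 phi -> C1 psi -> C1 (fun y => phi y + psi y).
Proof.
move=> [dp cp] [dq cq]; split; first by move=> x; exact: differentiableD.
rewrite (_ : grad _ = fun x => grad phi x + grad psi x); last first.
  by apply/funext => x; exact: gradD.
by move=> x; apply: continuousD; [exact: cp | exact: cq].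
Qed.

Lemma C1_continuous phi : C1 phi -> continuous phi.
Proof. by move=> [dp _] x; exact: differentiable_continuous. Qed.

(** [c] times the squared Euclidean distance to [a]. A negative [c] serves for touching from below,
    and [c = 0] gives a constant test function. *)
Definition paraboloid (c : R) a : V -> R := sepfun (fun z => c * z ^+ 2) a.

Let is_derive_sq (c z : R) : is_derive z (1 : R) (fun z => c * z ^+ 2) (2 * c * z).
Proof.
apply: is_derive_eq; rewrite /= /GRing.scale/=; ring.
Qed.

Lemma C1_paraboloid c a : C1 (paraboloid c a).
Proof.
apply: (C1_sepfun a (is_derive_sq c)) => z.
exact: (@mulrl_continuous R (2 * c)).
Qed.

Lemma grad_paraboloid c a x : grad (paraboloid c a) x = (2 * c) *: (x - a).
Proof.
by rewrite (grad_sepfun a (is_derive_sq c)); apply/rowP => j; rewrite !mxE.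
Qed.

Lemma paraboloid_center c a : paraboloid c a a = 0.
Proof. by rewrite /paraboloid /sepfun big1// => j _; rewrite subrr expr0n mulr0. Qed.

Lemma paraboloid_sym c a x : paraboloid c a x = paraboloid c x a.
Proof. by apply: eq_bigr => j _; rewrite -sqrrN opprB. Qed.

Lemma paraboloidN c a x : paraboloid (- c) a x = - paraboloid c a x.
Proof. by rewrite /paraboloid /sepfun -sumrN; apply: eq_bigr => j _; rewrite mulNr. Qed.

Lemma le_paraboloid c a x : 0 <= c -> c * `|x - a| ^+ 2 <= paraboloid c a x.
Proof.
move=> c0; have [xa0|xa0] := leP (`|x - a|) 0.
  rewrite (_ : `|x - a| = 0); last by apply/eqP; rewrite eq_le xa0/= normr_ge0.
  by rewrite expr0n mulr0 /paraboloid /sepfun sumr_ge0// => j _; rewrite mulr_ge0// sqr_ge0.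
have [j] := norm_rV_exists xa0 (lexx _); rewrite !mxE => le.
rewrite /paraboloid /sepfun (bigD1 j)//=.
apply: (@le_trans _ _ (c * (x 0 j - a 0 j) ^+ 2)).
  by rewrite ler_wpM2l// -[leRHS]real_normK ?num_real ?lerXn2r// ?nnegrE.
by rewrite lerDl sumr_ge0// => i _; rewrite mulr_ge0// sqr_ge0.
Qed.

(* Away from the [e]-ball some coordinate of [x - a] is at least [e], and the
   slope [2 L t / sqrt (t^2 + e^2)] is at least [L] for such [t]. *)
Definition cone (L e : R) a : V -> R :=
  sepfun (fun z => 2 * L * Num.sqrt (z ^+ 2 + e ^+ 2)) a.

Section Cone.
Variables (L e : R) (a : V).
Hypotheses (L0 : 0 < L) (e0 : 0 < e).

Let pos z : 0 < z ^+ 2 + e ^+ 2.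
Proof. by rewrite ltr_wpDl ?sqr_ge0 ?exprn_gt0. Qed.

Let spos z : 0 < Num.sqrt (z ^+ 2 + e ^+ 2).
Proof. by rewrite sqrtr_gt0. Qed.

Let cone_der (z : R) : is_derive z (1 : R) (fun z => 2 * L * Num.sqrt (z ^+ 2 + e ^+ 2))
  (2 * L * (z / Num.sqrt (z ^+ 2 + e ^+ 2))).
Proof.
have d1 : is_derive z 1 (fun z : R => z ^+ 2 + e ^+ 2) (2 * z).
  by apply: is_derive_eq; rewrite /= /GRing.scale/=; ring.
have d2 := is_derive1_sqrt (pos z).
have d3 := @is_derive1_comp R Num.sqrt (fun z => z ^+ 2 + e ^+ 2) z _ _ d2 d1.
have d4 := @is_deriveZ _ _ _ _ (2 * L) _ _ _ d3.
apply: (@is_derive_eq _ _ _ _ _ _ _ _ d4).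
rewrite /= /GRing.scale/=; field.
by rewrite gt_eqF.
Qed.

Lemma C1_cone : C1 (cone L e a).
Proof.
apply: (C1_sepfun a cone_der) => z.
apply: cvgM; first exact: cvg_cst.
apply: cvgM; first exact: cvg_id.
apply: cvgV; first by rewrite gt_eqF.
have cz : (fun y : R => y ^+ 2 + e ^+ 2) @ z --> z ^+ 2 + e ^+ 2.
  by apply: cvgD; [exact: exprn_continuous | exact: cvg_cst].
exact: (cvg_comp _ _ cz (@sqrt_continuous R _)).
Qed.

Lemma cone_ge0 x : 0 <= cone L e a x.
Proof. by apply: sumr_ge0 => j _; rewrite !mulr_ge0// ?sqrtr_ge0// ltW. Qed.

Lemma cone_ge x : 2 * L * `|x - a| <= cone L e a x.
Proof.
have [xa0|xa0] := leP (`|x - a|) 0.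
  apply: le_trans (cone_ge0 x); rewrite mulr_ge0_le0// mulr_ge0// ltW//.
have [j] := norm_rV_exists xa0 (lexx _); rewrite !mxE => le.
rewrite /cone /sepfun (bigD1 j)//=.
apply: (@le_trans _ _ (2 * L * Num.sqrt ((x 0 j - a 0 j) ^+ 2 + e ^+ 2))).
  rewrite ler_wpM2l ?mulr_ge0 ?(ltW L0)//; apply: le_trans le _.
  by rewrite -sqrtr_sqr ler_wsqrtr// lerDl sqr_ge0.
by rewrite lerDl sumr_ge0// => i _; rewrite !mulr_ge0 ?sqrtr_ge0// (ltW L0).
Qed.

Lemma cone_le x : cone L e a x <= 2 * L * d%:R * (`|x - a| + e).
Proof.
rewrite /cone /sepfun (_ : 2 * L * d%:R * _ = \sum_(j < d) (2 * L * (`|x - a| + e))); last first.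
  by rewrite sumr_const card_ord -[RHS]mulr_natl; ring.
apply: ler_sum => j _; rewrite ler_wpM2l ?mulr_ge0 ?(ltW L0)//.
have := coord_le_norm (x - a) j; rewrite !mxE => le.
have n0 : 0 <= `|x - a| + e by rewrite addr_ge0// ltW.
rewrite -[leRHS](ger0_norm n0) -sqrtr_sqr ler_wsqrtr//.
have : (x 0 j - a 0 j) ^+ 2 <= `|x - a| ^+ 2.
  by rewrite -[leLHS]real_normK ?num_real ?lerXn2r// ?nnegrE.
have : 0 <= `|x - a| * e by rewrite mulr_ge0// ltW.
nra.
Qed.

Lemma grad_cone x : e <= `|x - a| -> L <= `|grad (cone L e a) x|.
Proof.
move=> /(norm_rV_exists e0)[j]; rewrite !mxE => le.
apply: le_trans (coord_le_norm _ j).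
rewrite (grad_sepfun a cone_der) mxE; set z := x 0 j - a 0 j in le *.
rewrite !normrM (@gtr0_norm _ 2)// (gtr0_norm L0) (@gtr0_norm _ _^-1) ?invr_gt0//.
rewrite mulrA ler_pdivlMr// mulrAC mulrC ler_wpM2r ?(ltW L0)//.
rewrite (_ : 2 * `|z| = Num.sqrt ((2 * `|z|) ^+ 2)); last first.
  by rewrite sqrtr_sqr normrM normr_id (@ger0_norm _ 2).
rewrite ler_wsqrtr// exprMn real_normK ?num_real//.
have : e ^+ 2 <= z ^+ 2 by rewrite -[leRHS]real_normK ?num_real ?lerXn2r// ?nnegrE// ltW.
have := sqr_ge0 z; nra.
Qed.

End Cone.
End TestFunctions.

(** * Maxima *)

Section Maxima.
Context {R : realType} {d : nat}.
Notation V := 'rV[R]_d.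
Implicit Types (x y a z : V) (g u w phi : V -> R) (r e : R).

Definition cball a r : set V := [set y | `|y - a| <= r].

Lemma compact_cball a r : compact (cball a r).
Proof.
apply: bounded_closed_compact.
  exists (`|a| + r); split; first exact: num_real.
  move=> M lM y /= ya; apply: le_trans (ltW lM).
  by rewrite -[y](subrK a) (le_trans (ler_normD _ _))// addrC lerD2l.
rewrite (_ : cball a r = (fun y => `|y - a|) @^-1` [set t | t <= r])//.
apply: closed_comp; last exact: closed_le.
move=> y _; have cy : (fun z : V => z - a) @ y --> y - a.
  exact: (cvgB cvg_id (cvg_cst a)).
exact: (cvg_norm cy).
Qed.

Lemma cball_max g a r : 0 <= r -> continuous g ->
  exists2 xh, `|xh - a| <= r & forall y, `|y - a| <= r -> g y <= g xh.
Proof.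
move=> r0 cg; have ne : cball a r !=set0 by exists a; rewrite /cball /= subrr normr0.
have [xh /set_mem xhB H] := compact_EVT_max ne (@compact_cball a r) (continuous_subspaceT cg).
by exists xh => // y yB; apply: H; apply/mem_set.
Qed.

Lemma near_norm_lt x (P : V -> Prop) :
  (\forall y \near x, P y) <-> exists2 r, 0 < r & forall y, `|y - x| < r -> P y.
Proof.
split.
  move/nbhs_normP => [r r0 H]; exists r => // y yx; apply: H => /=.
  by rewrite distrC.
move=> [r r0 H]; apply/nbhs_normP; exists r => // y /=; rewrite distrC; exact: H.
Qed.

Lemma near_all x (P : V -> Prop) : (forall y, P y) -> \forall y \near x, P y.
Proof. by move=> H; apply/near_norm_lt; exists 1. Qed.

(** The maximum over the closed ball cannot lie on the sphere, where [g] is below its value at the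
    centre, so it is a local maximum. *)
Lemma interior_max g x r : 0 < r -> continuous g ->
  (forall y, `|y - x| = r -> g y < g x) ->
  exists2 xh, `|xh - x| < r & \forall y \near xh, g y <= g xh.
Proof.
move=> r0 cg bd; have [xh xhr H] := cball_max x (ltW r0) cg.
have {}xhr : `|xh - x| < r.
  rewrite lt_neqAle xhr andbT; apply/eqP => /bd; apply/negP; rewrite -leNgt.
  by apply: H; rewrite subrr normr0 ltW.
exists xh => //; apply/near_norm_lt; exists (r - `|xh - x|); first by rewrite subr_gt0.
move=> y yxh; apply: H; rewrite -[y - x](subrKA xh).
by rewrite (le_trans (ler_normD _ _))// -lerBrDr ltW.
Qed.

Lemma coercive_max g a r : 0 <= r -> continuous g ->
  (forall y, r < `|y - a| -> g y <= g a) -> exists xh, forall y, g y <= g xh.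
Proof.
move=> r0 cg co; have [xh _ H] := cball_max a r0 cg.
exists xh => y; have [/H//|/co ya] := leP (`|y - a|) r.
by apply: le_trans ya _; apply: H; rewrite subrr normr0.
Qed.

(** Subtracting a steep paraboloid centred at [x] creates a local maximum as close to [x] as
    desired, with no smoothness of [u]. *)
Lemma touching_dense u x r : 0 < r -> continuous u ->
  exists c xh, `|xh - x| < r /\
    \forall y \near xh, u y - paraboloid c x y <= u xh - paraboloid c x xh.
Proof.
move=> r0 cu; have [m mr H] := cball_max x (ltW r0) cu.
(* With this [c] the paraboloid is at least [u m - u x + 1] on the sphere of radius [r], so the
   difference there is below [u x]. *)
pose c := (u m - u x + 1) / r ^+ 2.
have uxm : u x <= u m by apply: H; rewrite subrr normr0 ltW.
have c0 : 0 <= c by rewrite divr_ge0 ?exprn_ge0 ?(ltW r0)//; lra.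
have cq : continuous (fun y => u y - paraboloid c x y).
  by move=> y; exact: (cvgB (cu y) (C1_continuous (C1_paraboloid c x) (x := y))).
have [|xh xhr Hx] := interior_max r0 cq (x := x); last by exists c, xh.
move=> y yr; rewrite paraboloid_center subr0.
have := le_paraboloid x y c0; rewrite yr divfK ?gt_eqF ?exprn_gt0//.
by have := H y; rewrite yr lexx => /(_ isT); lra.
Qed.

(* Adding a paraboloid makes the maximum strict, so that it persists near [x]
   under small uniform perturbations of [u]. *)
Lemma touching_stable u phi x r : 0 < r -> continuous u -> continuous phi ->
  (\forall y \near x, u y - phi y <= u x - phi x) ->
  exists2 e, 0 < e & forall w, continuous w -> (forall y, `|w y - u y| < e) ->
    exists2 xh, `|xh - x| < r &
      \forall y \near xh, w y - (phi y + paraboloid 1 x y) <=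
                          w xh - (phi xh + paraboloid 1 x xh).
Proof.
move=> r0 cu cphi /near_norm_lt[s s0 H].
(* [t < s] keeps the sphere of radius [t] in the region where [x] maximizes [u - phi]. *)
pose t := Num.min r (s / 2).
have t0 : 0 < t by rewrite lt_min r0/= divr_gt0.
(* The paraboloid is at least [t ^+ 2] on that sphere, while replacing [u] by [w] changes a
   difference of two values by less than [t ^+ 2]. *)
exists (t ^+ 2 / 2); first by rewrite divr_gt0 ?exprn_gt0.
move=> w cw wu.
have cq : continuous (fun y => w y - (phi y + paraboloid 1 x y)).
  by move=> y; exact: (cvgB (cw y) (cvgD (cphi y) (C1_continuous (C1_paraboloid 1 x) (x := y)))).
have [|xh xhr Hx] := interior_max t0 cq (x := x).
  move=> y yt; rewrite paraboloid_center addr0.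
  have := le_paraboloid x y (@ler01 R); rewrite yt mul1r.
  have /H : `|y - x| < s.
    by rewrite yt (@le_lt_trans _ _ (s / 2))// ?ge_min ?lexx ?orbT// ltr_pdivrMr// ltr_pMr// ltr1n.
  have := wu y; have := wu x; rewrite !ltr_norml => /andP[? ?] /andP[? ?]; lra.
exists xh => //; apply: lt_le_trans xhr _; by rewrite ge_min lexx.
Qed.

(** [z] collects the integer parts of the coordinates of [x]. It is chosen before [g], so one shift
    serves several periodic functions at once. *)
Lemma periodic_shift x : exists z,
  (forall (T : Type) (g : V -> T), Defs.periodic g -> forall y, g (y - z) = g y) /\
  `|x - z| <= 1.
Proof.
exists (\sum_(j < d) (delta_mx 0 j *~ Num.floor (x 0 j))); split.
  move=> T g pg.
  have pN y j : g (y - delta_mx 0 j) = g y by rewrite -[in RHS](subrK (delta_mx 0 j) y) pg.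
  have pn (n : nat) y j : g (y - delta_mx 0 j *+ n) = g y.
    elim: n y => [|n IH] y; first by rewrite mulr0n subr0.
    by rewrite mulrSr opprD addrA pN IH.
  have pm (n : nat) y j : g (y + delta_mx 0 j *+ n) = g y.
    by rewrite -(pn n (y + _) j) addrK.
  have pz (n : int) y j : g (y - delta_mx 0 j *~ n) = g y.
    case: n => n; first exact: pn.
    by rewrite NegzE mulrNz opprK pm.
  elim/big_ind : _ => [y|z1 z2 H1 H2 y|j _ y]; first by rewrite subr0.
    by rewrite opprD addrA H2 H1.
  exact: pz.
rewrite leNgt; apply/negP => lt1.
have [j] := norm_rV_exists (lt_trans ltr01 lt1) (lexx _).
apply/negP; rewrite -ltNge; apply: le_lt_trans lt1.
rewrite !mxE summxE (bigD1 j)//= big1 ?addr0; last first.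
  move=> i ij; rewrite -scaler_int !mxE eq_sym (negbTE ij) andbF mulr0//.
rewrite -scaler_int !mxE !eqxx mulr1.
have := floor_le_tmp (x 0 j); have := lt_succ_floor (x 0 j).
rewrite -[(_ + 1)%:~R]/((_ + 1)%:~R) intrD => h1 h2.
by rewrite ger0_norm; lra.
Qed.

Lemma periodic_max u : continuous u -> Defs.periodic u -> exists xh, forall y, u y <= u xh.
Proof.
move=> cu pu; have [xh _ H] := cball_max 0 (@ler01 R) cu.
exists xh => y; have [z [Hz yz]] := periodic_shift y.
by rewrite -(Hz _ _ pu y) H// subr0.
Qed.

Lemma periodic_min u : continuous u -> Defs.periodic u -> exists xh, forall y, u xh <= u y.
Proof.
move=> cu pu.
have [||xh H] := @periodic_max (fun y => - u y); last by exists xh => y; rewrite -lerN2.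
- by move=> y; exact: (cvgN (cu y)).
- by move=> y j; rewrite pu.
Qed.

End Maxima.

(** * The coupling kernel *)

(** Completeness of the space of row vectors is what Baire's theorem requires in [lsc_near_max]. *)
HB.instance Definition _ (R : realType) (m n : nat) := Complete.on 'M[R]_(m, n).

(** * Baire category and lower semicontinuous functions *)

Section Semicontinuity.
Context {R : realType} {V : completeNormedModType R}.

(* By Baire, [A] is bounded on some open subset of any ball; there a point
   where [A] nearly reaches its supremum is the desired one. *)
Lemma lsc_near_max (A : V -> R) (x0 : V) (r : R) :
  (forall x (e : R), 0 < e -> \forall y \near x, A x - e < A y) -> 0 < r ->
  exists2 x, `|x - x0| < r & \forall y \near x, A y <= A x + 1.
Proof.
move=> lscA r0.
(* If all these open sets were dense, Baire would give a point within [r / 2] of [x0] at which [A]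
   exceeds every integer. Hence some [F n] misses a nonempty open set, which lies in the closed half
   ball and on which [A] is at most [n]. *)
pose F (n : nat) : set V := [set y | n%:R < A y] `|` [set y | r / 2 < `|y - x0|].
have oF n : open (F n).
  apply: openU.
    rewrite openE => y /= yn; have e0 : 0 < A y - n%:R by rewrite subr_gt0.
    by apply: filterS (lscA y _ e0) => z /=; lra.
  rewrite (_ : [set y | _] = (fun y => `|y - x0|) @^-1` [set t | r / 2 < t])//.
  apply: open_comp; last exact: open_gt.
  move=> y _; have cy : (fun z : V => z - x0) @ y --> y - x0.
    exact: (cvgB cvg_id (cvg_cst x0)).
  exact: (cvg_norm cy).
have [n nd] : exists n, ~ dense (F n).
  apply/not_existsP => H.
  have /(_ (ball x0 (r / 2))) : dense (\bigcap_n F n).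
    by apply: Baire => n; split => //; exact/not_notP.
  case.
  - by exists x0; apply: ballxx; rewrite divr_gt0.
  - exact: ball_open.
  move=> y []; rewrite -ball_normE /= distrC => yb Hy.
  have := Hy (Num.truncn (A y)).+1 Logic.I; case => /=.
    by apply/negP; rewrite -leNgt ltW// truncnS_gt.
  by rewrite ltNge ltW.
have [U [[z Uz] [oO OFe]]] : exists U : set V, U !=set0 /\ open U /\ U `&` F n = set0.
  move/existsNP : nd => [U /not_implyP[One /not_implyP[oO H]]]; exists U; split => //; split => //.
  by apply/eqP/negP => /negP/set0P.
have Ob y : U y -> A y <= n%:R /\ `|y - x0| <= r / 2.
  move=> Oy; rewrite !leNgt; split; apply/negP => H.
    by suff : (U `&` F n) y by [rewrite OFe]; split => //; left.
  by suff : (U `&` F n) y by [rewrite OFe]; split => //; right.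
have hs : has_sup (A @` U).
  split; first by exists (A z), z.
  by exists n%:R => _ [y Oy <-]; case: (Ob y Oy).
have [_ [x Ox <-] xs] := sup_adherent (@ltr01 R) hs.
exists x.
  by case: (Ob x Ox) => _ /le_lt_trans; apply; rewrite ltr_pdivrMr// ltr_pMr// ltr1n.
move: oO; rewrite openE => /(_ x Ox); apply: filterS => y Oy.
have : A y <= sup (A @` U) by apply: sup_upper_bound => //; exists y.
lra.
Qed.

End Semicontinuity.

(** * The integral operator [K] and maximum principles for the coupling *)

Section Kernel.
Context {R : realType}.
Variables (I : interval R) (k : R -> R -> R) (k0 k1 : R).
Notation mu := (@lebesgue_measure R).
Hypothesis I1 : mu (Iset I) = 1%:E.
Hypothesis mk : measurable_fun (Iset I `*` Iset I) (fun z : R * R => k z.1 z.2).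
Hypothesis k0_gt0 : 0 < k0.
Hypothesis kb : forall xi eta, xi \in I -> eta \in I -> k0 <= k xi eta <= k1.

Notation integ g := (mu.-integrable (Iset I) (EFin \o g)).
Notation "'int' g" := (\int[mu]_(eta in Iset I) g eta) (at level 10, g at level 9).
Implicit Types (g h : R -> R) (xi eta a c : R).

Lemma measurable_I : @measurable _ (measurableTypeR R) (Iset I). Proof. exact: measurable_itv. Qed.
Let mI := measurable_I.

Lemma measure_I_fin : (mu (Iset I) < +oo)%E.
Proof. by rewrite I1 ltry. Qed.

Lemma I_nonempty : exists xi, xi \in I.
Proof.
apply: contrapT => /forallNP H.
have : Iset I = set0 by rewrite -subset0 => x /H.
by move=> E; move: I1; rewrite E measure0 => /eqP; rewrite eqe eq_sym oner_eq0.
Qed.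

Lemma integral_cst_I c : int (fun=> c) = c.
Proof. by rewrite Rintegral_cst// [X in fine X]I1 mulr1. Qed.

Lemma integrable_cst_I c : integ (fun=> c).
Proof. by apply: (integrable_bounded mI (c := `|c|) measure_I_fin). Qed.

Lemma measurable_k xi : xi \in I -> measurable_fun (Iset I) (k xi).
Proof.
move=> xiI; have := @measurable_comp _ _ _ _ _ _ (Iset I `*` Iset I) _ (Iset I) (pair xi) _ _ mk.
apply.
- exact: measurableX.
- by move=> _ [eta etaI <-].
- by apply: measurable_funTS; exact: pair1_measurable.
Qed.

Lemma k_norm_le xi eta : xi \in I -> eta \in I -> `|k xi eta| <= k1.
Proof. by move=> h1 h2; have := kb h1 h2; rewrite ler_norml; move: k0_gt0; lra. Qed.

Lemma integrable_k xi g : xi \in I -> integ g -> integ (fun eta => k xi eta * g eta).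
Proof.
move=> xiI ig; apply: (integrableM_bounded mI (measurable_k xiI) _ ig).
by move=> eta etaI; exact: k_norm_le.
Qed.

(** By [couplingE], the coupling is a zeroth-order term with coefficient [kap xi] minus the
    order-preserving operator [K xi]. *)
Definition kap xi := int (k xi).
Definition K xi g := \int[mu]_(eta in Iset I) (k xi eta * g eta).

Lemma le_K xi g h : xi \in I -> integ g -> integ h ->
  (forall eta, eta \in I -> g eta <= h eta) -> K xi g <= K xi h.
Proof.
move=> xiI ig ih gh; apply: le_Rintegral => //; [exact: integrable_k..|].
move=> eta etaI; rewrite ler_wpM2l ?gh//.
by have := kb xiI etaI; move: k0_gt0; lra.
Qed.

Lemma K_cst xi c : xi \in I -> K xi (fun=> c) = kap xi * c.
Proof.
move=> xiI; rewrite /K RintegralZr//.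
by have := integrable_k xiI (integrable_cst_I 1); under eq_fun do rewrite mulr1.
Qed.

Lemma KB xi g h : xi \in I -> integ g -> integ h ->
  K xi (fun eta => g eta - h eta) = K xi g - K xi h.
Proof.
move=> xiI ig ih; rewrite /K -RintegralB//; [|exact: integrable_k..].
by apply: eq_Rintegral => eta _; rewrite mulrBr.
Qed.

Lemma kap_bounds xi : xi \in I -> k0 <= kap xi <= k1.
Proof.
move=> xiI; have ik : integ (k xi).
  by have := integrable_k xiI (integrable_cst_I 1); under eq_fun do rewrite mulr1.
rewrite -{1}(integral_cst_I k0) -(integral_cst_I k1); apply/andP; split;
  apply: le_Rintegral => //; try exact: integrable_cst_I;
  by move=> eta etaI; case/andP: (kb xiI etaI).
Qed.

Lemma K_ub xi g c : xi \in I -> integ g -> (forall eta, eta \in I -> g eta <= c) ->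
  K xi g <= kap xi * c.
Proof.
by move=> xiI ig gc; rewrite -K_cst//; apply: le_K => //; exact: integrable_cst_I.
Qed.

Lemma K_lb xi g c : xi \in I -> integ g -> (forall eta, eta \in I -> c <= g eta) ->
  kap xi * c <= K xi g.
Proof.
by move=> xiI ig gc; rewrite -K_cst//; apply: le_K => //; exact: integrable_cst_I.
Qed.

Lemma K_le_integral xi g : xi \in I -> integ g ->
  (forall eta, eta \in I -> 0 <= g eta) -> K xi g <= k1 * int g.
Proof.
move=> xiI ig g0; rewrite -RintegralZl//; apply: le_Rintegral => //.
- exact: integrable_k.
- by have := @integrableZl _ _ _ _ _ mI k1 _ ig.
- by move=> eta etaI; rewrite ler_wpM2r ?g0//; case/andP : (kb xiI etaI).
Qed.

Lemma K_ge_integral xi g : xi \in I -> integ g ->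
  (forall eta, eta \in I -> 0 <= g eta) -> k0 * int g <= K xi g.
Proof.
move=> xiI ig g0; rewrite -RintegralZl//; apply: le_Rintegral => //.
- by have := @integrableZl _ _ _ _ _ mI k0 _ ig.
- exact: integrable_k.
- by move=> eta etaI; rewrite ler_wpM2r ?g0//; case/andP : (kb xiI etaI).
Qed.

Lemma couplingE d (u : 'rV[R]_d -> R -> R) x xi : xi \in I -> integ (u x) ->
  coupling I k u x xi = kap xi * u x xi - K xi (u x).
Proof.
move=> xiI iu; rewrite /coupling -K_cst// -KB//; last exact: integrable_cst_I.
Qed.

(** Maximum principle in [xi]: with [S] the supremum of [g], the bound [K xi g <= kap xi * S]
    absorbs [kap xi * g xi] near the supremum and leaves [a * S <= c]. *)
Lemma le_zero_order_sub a c g : 0 < a -> integ g ->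
  (forall xi, xi \in I -> (a + kap xi) * g xi <= c + K xi g) ->
  forall xi, xi \in I -> g xi <= c / a.
Proof.
move=> a0 ig H.
have iN : integ (fun eta => `|g eta|).
  by have := integrable_norm ig.
(* [g] is only integrable, so its supremum must first be shown finite; the hypothesis bounds [g]
   through the integral of its absolute value. *)
have bg xi : xi \in I -> g xi <= (`|c| + k1 * int (fun eta => `|g eta|)) / k0.
  move=> xiI; have := H _ xiI; have /andP[kk kk'] := kap_bounds xiI.
  have K1 : K xi g <= k1 * int (fun eta => `|g eta|).
    apply: le_trans (K_le_integral xiI iN _); last by [].
    by apply: le_K => // eta _; exact: ler_norm.
  have := ler_norm c.
  rewrite ler_pdivlMr//; have [g0|g0] := leP 0 (g xi); last first.
    have : 0 <= k1 * int (fun eta => `|g eta|).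
      by rewrite mulr_ge0 ?Rintegral_ge0//; move: k0_gt0; lra.
    have := normr_ge0 c; move: k0_gt0; nra.
  move: k0_gt0; nra.
pose S := sup (g @` Iset I).
have hs : has_sup (g @` Iset I).
  split; first by have [xi xiI] := I_nonempty; exists (g xi), xi.
  by exists ((`|c| + k1 * int (fun eta => `|g eta|)) / k0) => _ [xi xiI <-]; exact: bg.
have gS xi : xi \in I -> g xi <= S.
  by move=> xiI; apply: sup_upper_bound => //; exists xi.
have [SC|SC] := leP (a * S) c.
  by move=> xi xiI; apply: le_trans (gS _ xiI) _; rewrite ler_pdivlMr// mulrC.
have k10 : 0 < k1.
  by have [xi xiI] := I_nonempty; have := kb xiI xiI; move: k0_gt0; lra.
(* If [a * S > c], the inequality at each [xi] puts [g xi] below [S] by a fixed amount, so [S] is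
   not the least upper bound. *)
exfalso; suff : S <= S - (a * S - c) / (a + k1).
  by apply/negP; rewrite -ltNge ltrBlDr ltrDl divr_gt0 ?subr_gt0// addr_gt0.
apply: ge_sup; first by case: hs.
move=> _ [xi xiI <-]; have /andP[kk kk'] := kap_bounds xiI.
have := H _ xiI; have := K_ub xiI ig gS => h1 h2.
have h3 : (a + kap xi) * (g xi - S) <= - (a * S - c) by nra.
have gSx := gS _ xiI.
suff : (a * S - c) / (a + k1) <= S - g xi by lra.
rewrite ler_pdivrMr ?addr_gt0//; nra.
Qed.

(* Each [x -> v x xi] reaches its minimum, where the sign of the gradient term
   is known; the coupling then propagates nonnegativity. *)
Lemma ge0_zero_order_super (V : Type) a b (v : V -> R -> R) : 0 < a ->
  (forall x, integ (v x)) -> (forall x xi, xi \in I -> b <= v x xi) ->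
  (forall xi, xi \in I -> exists2 xh, forall x, v xh xi <= v x xi &
     K xi (v xh) <= (a + kap xi) * v xh xi) ->
  forall x xi, xi \in I -> 0 <= v x xi.
Proof.
move=> a0 iv vb H x0 xi0 xi0I.
pose E := [set t | exists x, exists2 xi, xi \in I & t = v x xi].
have hi : has_inf E.
  split; first by exists (v x0 xi0), x0, xi0.
  by exists b => _ [x [xi xiI ->]]; exact: vb.
pose m := inf E.
have mv x xi : xi \in I -> m <= v x xi.
  by move=> xiI; apply: inf_lbound; [case: hi|exists x, xi].
suff m0 : 0 <= m by apply: le_trans m0 (mv _ _ xi0I).
have k10 : 0 < k1.
  by have := kb xi0I xi0I; move: k0_gt0; lra.
rewrite leNgt; apply/negP => mlt0.
(* As [m < 0], the left side exceeds [m]. Yet it bounds all values from below, since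
   [(a + kap xi) * (v xh xi - m) >= - m * a] at each minimum point [xh]. *)
suff : m - m * a / (a + k1) <= m.
  by apply/negP; rewrite -ltNge ltrBrDl gtrDr -mulrA pmulr_llt0 ?divr_gt0 ?addr_gt0.
apply: lb_le_inf; first by case: hi.
move=> _ [x [xi xiI ->]]; have [xh xmin Kh] := H _ xiI.
apply: le_trans (xmin x).
have /andP[kk kk'] := kap_bounds xiI.
have := K_lb xiI (iv xh) (mv xh) => h1.
suff : - m * a / (a + k1) <= v xh xi - m by lra.
have h2 := mv xh _ xiI.
rewrite ler_pdivrMr ?addr_gt0//; nra.
Qed.

End Kernel.

(** * Bounds for a fixed discount *)

Section Discounted.
Context {R : realType} {d : nat}.
Notation V := 'rV[R]_d.
Variables (I : interval R) (k : R -> R -> R) (k0 k1 : R).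
Notation mu := (@lebesgue_measure R).
Hypothesis I1 : mu (Iset I) = 1%:E.
Hypothesis mk : measurable_fun (Iset I `*` Iset I) (fun z : R * R => k z.1 z.2).
Hypothesis k0_gt0 : 0 < k0.
Hypothesis kb : forall xi eta, xi \in I -> eta \in I -> k0 <= k xi eta <= k1.
Variables (F : V -> V -> R -> R) (f : V -> R -> R) (M : R).
Hypothesis F_ge0 : forall x p xi, xi \in I -> 0 <= F x p xi.
Hypothesis F0 : forall x xi, xi \in I -> F x 0 xi = 0.
Hypothesis f_ge0 : forall x xi, xi \in I -> 0 <= f x xi.
Hypothesis f_le : forall x xi, xi \in I -> f x xi <= M.
Hypothesis cf : forall xi, continuous (f ^~ xi).
Variables (alpha : R) (v : V -> R -> R).
Hypothesis alpha_gt0 : 0 < alpha.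
Hypothesis CBv : CB I v.
Hypothesis solv : visc_sol I k alpha F f v.

Notation integ g := (mu.-integrable (Iset I) (EFin \o g)).
Notation int g := (\int[mu]_(eta in Iset I) g eta).
Notation kap := (kap I k).
Notation K := (K I k).
Let mI := measurable_I I.
Let kapP := kap_bounds I1 mk k0_gt0 kb.

Lemma sol_integrable x : integ (v x).
Proof. by case: solv => -[[H _] _] _; case: (H x). Qed.
Let iv := sol_integrable.

Lemma sol_continuous xi : continuous (v ^~ xi).
Proof. by case: CBv => H _; case: (H xi). Qed.
Let cv := sol_continuous.

Lemma sol_periodic xi : Defs.periodic (v ^~ xi).
Proof. by case: CBv => H _; case: (H xi). Qed.

Lemma sol_sub phi xi xh : C1 phi -> xi \in I ->
  (\forall y \near xh, v y xi - phi y <= v xh xi - phi xh) ->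
  (alpha + kap xi) * v xh xi + F xh (grad phi xh) xi <= f xh xi + K xi (v xh).
Proof.
move=> Cp xiI H; case: solv => -[_ /(_ _ _ _ Cp xiI H)] + _.
by rewrite (couplingE I1 mk k0_gt0 kb)//; lra.
Qed.

Lemma sol_super phi xi xh : C1 phi -> xi \in I ->
  (\forall y \near xh, v xh xi - phi xh <= v y xi - phi y) ->
  f xh xi + K xi (v xh) <= (alpha + kap xi) * v xh xi + F xh (grad phi xh) xi.
Proof.
move=> Cp xiI H; case: solv => _ [_ /(_ _ _ _ Cp xiI H)].
by rewrite (couplingE I1 mk k0_gt0 kb)//; lra.
Qed.

(* Touching points from above are dense and there [F >= 0] can be dropped. *)
Lemma pointwise_sub_gen x xi G : xi \in I ->
  (forall e, 0 < e -> \forall y \near x, K xi (v y) <= G + e) ->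
  (alpha + kap xi) * v x xi <= f x xi + G.
Proof.
move=> xiI H; have /andP[kk kk'] := kapP xiI.
have p0 : 0 < alpha + kap xi + 2 by move: alpha_gt0 k0_gt0; lra.
(* Moving from [xh] to [x] costs [(alpha + kap xi) * e'] in [v] and [e'] in each of [f] and [G],
   which adds up to [e]. *)
apply/ler_addgt0Pr => e e0; pose e' := e / (alpha + kap xi + 2).
have e'0 : 0 < e' by rewrite divr_gt0.
have /near_norm_lt[r r0 Hr] : \forall y \near x,
    [/\ K xi (v y) <= G + e', v x xi - e' < v y xi & f y xi < f x xi + e'].
  have /cvgrPdist_lt/(_ _ e'0) c1 := @cv xi x.
  have /cvgrPdist_lt/(_ _ e'0) c2 := @cf xi x.
  near=> y; split.
  - by near: y; exact: H.
  - by have : `|v x xi - v y xi| < e' by [near: y]; rewrite ltr_norml; lra.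
  - by have : `|f x xi - f y xi| < e' by [near: y]; rewrite ltr_norml; lra.
have [c [xh [xhr Ht]]] := touching_dense x r0 (@cv xi).
have [h1 h2 h3] := Hr _ xhr.
have := sol_sub (C1_paraboloid c x) xiI Ht.
have := F_ge0 xh (grad (paraboloid c x) xh) xiI.
have : e = (alpha + kap xi + 2) * e' by rewrite /e' mulrC divfK// gt_eqF.
move: alpha_gt0 k0_gt0; nra.
Unshelve. all: by end_near. Qed.

(** [pos] and [neg] are twice the positive and negative parts of [v], whence the factors 2 below. *)
Let pos (y : V) (eta : R) : R := `|v y eta| + v y eta.
Let neg (y : V) (eta : R) : R := `|v y eta| - v y eta.

Let ipos y : integ (pos y).
Proof. by have := integrableD mI (integrable_norm (iv y)) (iv y). Qed.
Let ineg y : integ (neg y).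
Proof. by have := integrableB mI (integrable_norm (iv y)) (iv y). Qed.
Let pos_ge0 y eta : 0 <= pos y eta.
Proof. by have := ler_norm (- v y eta); rewrite normrN /pos; lra. Qed.
Let neg_ge0 y eta : 0 <= neg y eta.
Proof. by have := ler_norm (v y eta); rewrite /neg; lra. Qed.
Let cpos eta : continuous (pos ^~ eta).
Proof. by move=> x; exact: (cvgD (cvg_norm (@cv eta x)) (@cv eta x)). Qed.
Let cneg eta : continuous (neg ^~ eta).
Proof. by move=> x; exact: (cvgB (cvg_norm (@cv eta x)) (@cv eta x)). Qed.

Let lsc_pos (x : V) (e : R) : 0 < e -> \forall y \near x, int (pos x) - e < int (pos y).
Proof. by move=> e0; apply: (integral_lsc mI ipos) => // eta _; exact: cpos. Qed.
Let lsc_neg (x : V) (e : R) : 0 < e -> \forall y \near x, int (neg x) - e < int (neg y).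
Proof. by move=> e0; apply: (integral_lsc mI ineg) => // eta _; exact: cneg. Qed.

Let K_pos_neg xi y : xi \in I -> 2 * K xi (v y) = K xi (pos y) - K xi (neg y).
Proof.
move=> xiI; rewrite -(KB mk k0_gt0 kb xiI (ipos y) (ineg y)) -RintegralZl//; last first.
  exact: (integrable_k mk k0_gt0 kb).
by apply: eq_Rintegral => eta _; rewrite /pos /neg; ring.
Qed.

Let good (x : V) := \forall y \near x, int (pos y) <= int (pos x) + 1.

Let good_dense (x0 : V) (r : R) : 0 < r -> exists2 x, `|x - x0| < r & good x.
Proof. exact: (lsc_near_max x0 lsc_pos). Qed.

(** At a good point [K xi (v y)] is upper semicontinuous in [y] up to the error [k1], which is what
    [pointwise_sub_gen] asks for. Goodness does not involve [xi], so the inequality holds for all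
    [xi] at the same [x]. *)
Let good_sub x xi : xi \in I -> good x ->
  (alpha + kap xi) * v x xi <= M + k1 + K xi (v x).
Proof.
move=> xiI gx.
suff : (alpha + kap xi) * v x xi <= f x xi + (k1 + K xi (v x)).
  by have := f_le x xiI; lra.
apply: pointwise_sub_gen => // e e0.
(* [Q] is nonnegative because [k xi eta <= k1], so its integral [k1 * int (pos y) - 2 * K xi (v y)]
   is lower semicontinuous. Since [int (pos y)] grows by at most 1 near [x], the growth of
   [K xi (v y)] is controlled. *)
pose Q y eta := (k1 - k xi eta) * pos y eta + k xi eta * neg y eta.
have iQ y : integ (Q y).
  have i1 := integrable_k mk k0_gt0 kb xiI (ipos y).
  have i2 := integrable_k mk k0_gt0 kb xiI (ineg y).
  have i3 : integ (fun eta => k1 * pos y eta).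
    by have := @integrableZl _ _ _ _ _ mI k1 _ (ipos y).
  have := integrableD mI (integrableB mI i3 i1) i2.
  by apply: eq_integrable => // eta _ /=; rewrite /Q mulrBl.
have QE y : int (Q y) = k1 * int (pos y) - 2 * K xi (v y).
  rewrite K_pos_neg//.
  have i1 := integrable_k mk k0_gt0 kb xiI (ipos y).
  have i2 := integrable_k mk k0_gt0 kb xiI (ineg y).
  have i3 : integ (fun eta => k1 * pos y eta).
    by have := @integrableZl _ _ _ _ _ mI k1 _ (ipos y).
  have i4 : integ (fun eta => k1 * pos y eta - k xi eta * pos y eta).
    by have := integrableB mI i3 i1.
  rewrite -RintegralZl// opprB addrA addrAC -RintegralB// -RintegralD//.
  by apply: eq_Rintegral => eta _; rewrite /Q mulrBl.
have Q0 y eta : Iset I eta -> 0 <= Q y eta.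
  move=> etaI; have /andP[? ?] := kb xiI etaI.
  by rewrite addr_ge0// mulr_ge0// ?subr_ge0//; move: k0_gt0; lra.
have cQ eta : continuous (Q ^~ eta).
  by move=> y; exact: (cvgD (cvgM (cvg_cst _) (@cpos eta y)) (cvgM (cvg_cst _) (@cneg eta y))).
have e2 : 0 < 2 * e by rewrite mulr_gt0.
have := integral_lsc mI iQ Q0 (fun eta _ => @cQ eta x) e2.
move: gx; apply: filterS2 => y; rewrite !QE.
have [xi0 xi0I] := I_nonempty I1; have := kb xi0I xi0I; move: k0_gt0.
by nra.
Qed.

Let B := (M + k1) / alpha.

(** At good points the maximum principle in [xi] applies to [good_sub]; density of these points and
    continuity of [v] in [x] give the bound everywhere. *)
Let v_le x xi : xi \in I -> v x xi <= B.
Proof.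
move=> xiI; rewrite leNgt; apply/negP => lt.
have : \forall y \near x, B < v y xi.
  have e0 : 0 < v x xi - B by rewrite subr_gt0.
  have /cvgrPdist_lt/(_ _ e0) := @cv xi x; apply: filterS => y.
  by rewrite ltr_norml; lra.
move=> /near_norm_lt[r r0 H]; have [y yr gy] := good_dense x r0.
have := H _ yr; apply/negP; rewrite -leNgt.
apply: (le_zero_order_sub I1 mk k0_gt0 kb alpha_gt0 (iv y) _ xiI).
by move=> eta etaI; exact: good_sub.
Qed.

(** One fixed [xi] suffices: there [v] is bounded below in [x], and [good_sub] converts this into a
    bound on the negative part at good points. Lower semicontinuity extends it to every [x]. *)
Let neg_bounded : exists2 C, 0 <= C & forall x, int (neg x) <= C.
Proof.
have [xi xiI] := I_nonempty I1.
have [xh xmin] := periodic_min (@cv xi) (@sol_periodic xi).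
have /andP[kk kk'] := kapP xiI.
(* [C] comes from [k0 * int (neg x) <= K xi (pos x) - 2 * K xi (v x)], where [v_le] bounds the first
   term, and [good_sub] with [v x xi >= - b] the second. *)
pose b := `|v xh xi|; pose C := 2 * (k1 * `|B| + M + k1 + (alpha + k1) * b) / k0.
have M0 : 0 <= M by apply: le_trans (f_ge0 xh xiI) (f_le xh xiI).
have H x : good x -> int (neg x) <= C.
  move=> gx; rewrite ler_pdivlMr// mulrC.
  have h1 := good_sub xiI gx; have h2 := K_pos_neg x xiI.
  have h3 := K_ge_integral mk k0_gt0 kb xiI (ineg x) (fun _ _ => neg_ge0 x _).
  have h4 : K xi (pos x) <= kap xi * (2 * `|B|).
    apply: (K_ub I1 mk k0_gt0 kb xiI (ipos x)) => eta etaI.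
    have := v_le x etaI; have := ler_norm B; have := normr_ge0 B; rewrite /pos.
    by have [v0|v0] := leP 0 (v x eta); [rewrite (ger0_norm v0)|rewrite (ltr0_norm v0)]; lra.
  have h5 : - b <= v x xi.
    by apply: le_trans (xmin x); have := ler_norm (- v xh xi); rewrite normrN /b; lra.
  have b0 : 0 <= b by exact: normr_ge0.
  have B0 := normr_ge0 B.
  have h6 : kap xi * (2 * `|B|) <= k1 * (2 * `|B|) by nra.
  have h7 : - ((alpha + k1) * b) <= (alpha + kap xi) * v x xi by move: alpha_gt0 k0_gt0; nra.
  by lra.
have k1_gt0 : 0 < k1 by move: k0_gt0; lra.
have b0 : 0 <= b by exact: normr_ge0.
exists C.
  rewrite divr_ge0 ?(ltW k0_gt0)//; have := normr_ge0 B; move: alpha_gt0; nra.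
move=> x; apply/ler_addgt0Pr => e e0.
have /near_norm_lt[r r0 Hr] := lsc_neg x e0.
have [y yr gy] := good_dense x r0.
by have := H _ gy; have := Hr _ yr; lra.
Qed.

Let at_min xi xh : xi \in I -> (forall y, v xh xi <= v y xi) ->
  K xi (v xh) <= (alpha + kap xi) * v xh xi.
Proof.
move=> xiI xmin.
have := @sol_super (paraboloid 0 0) xi xh (C1_paraboloid _ _) xiI.
rewrite grad_paraboloid mulr0 scale0r F0// => H.
have p0 y : paraboloid 0 0 y = 0 :> R by rewrite /paraboloid /sepfun big1// => j _; rewrite mul0r.
suff : f xh xi + K xi (v xh) <= (alpha + kap xi) * v xh xi + 0 by have := f_ge0 xh xiI; lra.
by apply: H; apply: near_all => y; rewrite !p0 !subr0.
Qed.

Let half_le (a b c : R) : 2 * a = b - c -> 0 <= b -> 0 <= c -> - c <= a.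
Proof. lra. Qed.

(** At the minimum over [x], [(alpha + kap xi) * v xh xi >= - (k1 * C)]; if [v xh xi] is negative,
    the coefficient can be lowered to [k0]. The resulting bound is the same for all [xi]. *)
Let v_ge xi : xi \in I -> forall C, (forall x, int (neg x) <= C) -> 0 <= C ->
  forall x, - (k1 * C / k0) <= v x xi.
Proof.
move=> xiI C HC C0 x.
have [xh xmin] := periodic_min (@cv xi) (@sol_periodic xi).
apply: le_trans (xmin x).
have h0 := at_min xiI xmin; have /andP[kk kk'] := kapP xiI.
have h1 : - K xi (neg xh) <= K xi (v xh).
  have h2 := K_pos_neg xh xiI.
  have h3 := K_ge_integral mk k0_gt0 kb xiI (ipos xh) (fun _ _ => pos_ge0 xh _).
  have h4 : 0 <= int (pos xh) by exact: Rintegral_ge0.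
  have h5 := K_ge_integral mk k0_gt0 kb xiI (ineg xh) (fun _ _ => neg_ge0 xh _).
  have h6 : 0 <= int (neg xh) by exact: Rintegral_ge0.
  have h7 : 0 <= k0 * int (pos xh) by rewrite mulr_ge0// ltW.
  have h8 : 0 <= k0 * int (neg xh) by rewrite mulr_ge0// ltW.
  exact: half_le h2 (le_trans h7 h3) (le_trans h8 h5).
have h2 := K_le_integral mk k0_gt0 kb xiI (ineg xh) (fun _ _ => neg_ge0 xh _).
have h3 := HC xh.
rewrite lerNl ler_pdivlMr//.
have k1C : 0 <= k1 * C by rewrite mulr_ge0//; move: k0_gt0; lra.
have h4 : k1 * int (neg xh) <= k1 * C by rewrite ler_wpM2l//; move: k0_gt0; lra.
have [vp|vn] := leP 0 (v xh xi).
  apply: le_trans k1C; rewrite mulNr oppr_le0 mulr_ge0// ltW//.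
have h5 : (alpha + kap xi) * v xh xi <= k0 * v xh xi.
  by rewrite ler_nM2r//; move: alpha_gt0; lra.
by lra.
Qed.

(** The crude lower bound makes the infimum over both variables finite; the minimum principle then
    raises it to 0. *)
Lemma sol_ge0 x xi : xi \in I -> 0 <= v x xi.
Proof.
have [C C0 HC] := neg_bounded; move=> xiI.
apply: (@ge0_zero_order_super _ I k k0 k1 I1 mk k0_gt0 kb V alpha (- (k1 * C / k0)) v) => //.
- by move=> y eta etaI; exact: v_ge.
- move=> eta etaI; have [xh xmin] := periodic_min (@cv eta) (@sol_periodic eta).
  by exists xh => //; exact: at_min.
Qed.

Lemma sol_bounded : exists C, forall x xi, xi \in I -> v x xi <= C.
Proof. by exists B. Qed.

(** Once [v <= B] is known, Fatou applied to [B - v] makes [K xi (v y)] genuinely upper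
    semicontinuous in [y], so the error constant of [good_sub] disappears. *)
Lemma pointwise_sub x xi : xi \in I ->
  (alpha + kap xi) * v x xi <= f x xi + K xi (v x).
Proof.
move=> xiI; apply: pointwise_sub_gen => // e e0.
have iB y : integ (fun eta => B - v y eta).
  by have := integrableB mI (integrable_cst_I I1 B) (iv y).
have ik y : integ (fun eta => k xi eta * (B - v y eta)) by exact: (integrable_k mk k0_gt0 kb).
have k_ge0 y eta : Iset I eta -> 0 <= k xi eta * (B - v y eta).
  move=> etaI; have := kb xiI etaI; have := v_le y etaI => h /andP[? ?].
  by rewrite mulr_ge0 ?subr_ge0//; move: k0_gt0; lra.
have ck eta : Iset I eta -> {for x, continuous (fun y => k xi eta * (B - v y eta))}.
  by move=> _; exact: (cvgM (cvg_cst _) (cvgB (cvg_cst B) (@cv eta x))).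
have := integral_lsc mI ik k_ge0 ck e0.
apply: filterS => y; rewrite -![Rintegral _ _ _]/(K xi _).
rewrite !(KB mk k0_gt0 kb xiI (integrable_cst_I I1 B) (iv _)); lra.
Qed.

(** Near a common zero of [f], where [f <= alpha], this yields [v <= 1] whatever the discount. *)
Lemma sol_le_source c x xi : xi \in I -> (forall eta, eta \in I -> f x eta <= c) ->
  v x xi <= c / alpha.
Proof.
move=> xiI fc; apply: (le_zero_order_sub I1 mk k0_gt0 kb alpha_gt0 (iv x) _ xiI).
by move=> eta etaI; apply: le_trans (pointwise_sub _ etaI) _; rewrite lerD2r fc.
Qed.

End Discounted.

(** * Uniform estimates and comparison *)

Section Estimates.
Context {R : realType} {d : nat}.
Notation V := 'rV[R]_d.
Variables (I : interval R) (k : R -> R -> R) (k0 k1 : R).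
Notation mu := (@lebesgue_measure R).
Hypothesis I1 : mu (Iset I) = 1%:E.
Hypothesis mk : measurable_fun (Iset I `*` Iset I) (fun z : R * R => k z.1 z.2).
Hypothesis k0_gt0 : 0 < k0.
Hypothesis kb : forall xi eta, xi \in I -> eta \in I -> k0 <= k xi eta <= k1.
Notation integ g := (mu.-integrable (Iset I) (EFin \o g)).
Notation kap := (kap I k).
Notation K := (K I k).
Let mI := measurable_I I.
Let kapP := kap_bounds I1 mk k0_gt0 kb.
Variables (F : V -> V -> R -> R) (f : V -> R -> R).

(** The viscosity inequalities alone, with the coupling split by [kap] and [K] and separated from
    the regularity built into [Uplus] and [Uminus]. *)
Definition test_sub beta (u : V -> R -> R) :=
  forall phi xi xh, C1 phi -> xi \in I ->
  (\forall y \near xh, u y xi - phi y <= u xh xi - phi xh) ->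
  (beta + kap xi) * u xh xi + F xh (grad phi xh) xi <= f xh xi + K xi (u xh).

Definition test_super beta (w : V -> R -> R) :=
  forall phi xi xh, C1 phi -> xi \in I ->
  (\forall y \near xh, w xh xi - phi xh <= w y xi - phi y) ->
  f xh xi + K xi (w xh) <= (beta + kap xi) * w xh xi + F xh (grad phi xh) xi.

(** * Bounds for subsolutions by touching cones *)

Section Subsolution.
Variables (M alpha B : R) (v : V -> R -> R).
Hypothesis f_le : forall x xi, xi \in I -> f x xi <= M.
Hypothesis alpha_gt0 : 0 < alpha.
Hypothesis cv : forall xi, continuous (v ^~ xi).
Hypothesis pv : forall xi, Defs.periodic (v ^~ xi).
Hypothesis iv : forall x, integ (v x).
Hypothesis v_ge0 : forall x xi, xi \in I -> 0 <= v x xi.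
Hypothesis v_le : forall x xi, xi \in I -> v x xi <= B.
Hypothesis vsub : test_sub alpha v.

Lemma cone_touching (L e : R) (a : V) xi : 0 < L -> 0 < e -> xi \in I ->
  exists xh, forall y, v y xi - cone L e a y <= v xh xi - cone L e a xh.
Proof.
(* Beyond distance [r] the cone exceeds [B] plus its value at the vertex, so the maximum is
   attained. *)
move=> L0 e0 xiI; pose r := (B + 2 * L * d%:R * e) / (2 * L).
have L2 : 0 < 2 * L by rewrite mulr_gt0.
have B0 : 0 <= B by apply: le_trans (v_ge0 a xiI) (v_le a xiI).
have ca := cone_le a L0 e0 a; rewrite subrr normr0 add0r in ca.
apply: (@coercive_max _ _ (fun y => v y xi - cone L e a y) a r).
- by rewrite divr_ge0 ?(ltW L2)// addr_ge0// !mulr_ge0// ltW.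
- by move=> y; exact: (cvgB (@cv xi y) (C1_continuous (C1_cone L a e0) (x := y))).
- move=> y; rewrite ltr_pdivrMr// mulrC => ya.
  have := cone_ge e a L0 y; have := v_ge0 a xiI; have := v_le y xiI; lra.
Qed.

(* The maximum over [x] of [v - cone] is nearly maximal over [xi] too, which
   bounds the coupling from below by [- k1]; coercivity then forces it into the
   ball where [v <= 1]. *)
Lemma uniform_bound (L e : R) (x0 : V) : 0 < L -> 0 < e -> e <= 1 ->
  (forall x p xi, xi \in I -> L <= `|p| -> M + k1 < F x p xi) ->
  (forall y xi, xi \in I -> `|y - x0| < e -> v y xi <= 1) ->
  forall x xi, xi \in I -> v x xi <= 4 * L * d%:R + 2.
Proof.
move=> L0 e0 e1 coF v1 x xi xiI; set phi := cone L e x0.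
pose E := [set t | exists y, exists2 eta, eta \in I & t = v y eta - phi y].
have phi0 y : 0 <= phi y by exact: cone_ge0.
have hs : has_sup E.
  split; first by exists (v x xi - phi x), x, xi.
  by exists B => _ [y [eta etaI ->]]; have := v_le y etaI; have := phi0 y; lra.
have [_ [y1 [eta etaI ->]] close] := sup_adherent (@ltr01 R) hs.
have [xh Hmax] := cone_touching x0 L0 e0 etaI.
have Eub z zeta : zeta \in I -> v z zeta - phi z <= sup E.
  by move=> zI; apply: sup_upper_bound => //; exists z, zeta.
have gap zeta : zeta \in I -> v xh zeta <= v xh eta + 1.
  by move=> zI; have := Eub xh _ zI; have := Hmax y1; rewrite -/phi; lra.
have xh_e : `|xh - x0| < e.
  (* Outside the ball the slope is at least [L], so [F] exceeds [M + k1]. The subsolution test gives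
     the opposite: by [gap] the coupling is at least [- kap eta], and the discount term is
     nonnegative. *)
  rewrite ltNge; apply/negP => /(grad_cone L0 e0) gL.
  have /(coF xh _ _ etaI) := gL; apply/negP; rewrite -leNgt.
  have := vsub (C1_cone L x0 e0) etaI (near_all xh Hmax).
  have := K_ub I1 mk k0_gt0 kb etaI (iv xh) gap.
  have := f_le xh etaI; have /andP[kk kk'] := kapP etaI.
  have : 0 <= alpha * v xh eta by rewrite mulr_ge0 ?v_ge0// ltW.
  rewrite -/phi; lra.
(* By periodicity [x] may be taken within distance 1 of [x0], where the cone is at most [4 * L * d];
   the 2 is [v <= 1] at [xh] plus the near-maximality error 1. *)
have [z [Hz xz]] := periodic_shift (x - x0).
have := Eub (x - z) _ xiI; rewrite (Hz _ _ (@pv xi)).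
have := Hmax y1; have := v1 _ _ etaI xh_e; have := phi0 xh; rewrite -/phi.
have := cone_le x0 L0 e0 (x - z); rewrite -/phi (addrAC x).
have : 2 * L * d%:R * (`|x - x0 - z| + e) <= 2 * L * d%:R * 2.
  by rewrite ler_wpM2l ?mulr_ge0 ?(ltW L0)//; lra.
lra.
Qed.

(** With [v <= B] the operator [K] contributes at most [k1 * B], so cones can have their vertex at
    any [y]: the maximum falls where [v] is close to [v y xi]. *)
Lemma lipschitz_bound (L : R) : 0 < L ->
  (forall x p xi, xi \in I -> L <= `|p| -> M + k1 * B < F x p xi) ->
  forall x y xi, xi \in I -> v x xi - v y xi <= 2 * L * d%:R * `|x - y|.
Proof.
move=> L0 coF x y xi xiI.
have B0 : 0 <= B by apply: le_trans (v_ge0 x xiI) (v_le x xiI).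
pose c := 2 * L * d%:R; have c0 : 0 <= c by rewrite !mulr_ge0// ltW.
rewrite lerBlDr; apply/ler_addgt0Pr => e' e'0.
(* The oscillation of [v] near [y] costs one such term and the rounding of the cone at most [c] of
   them, [e'] in all. *)
have e1 : 0 < e' / (1 + c) by rewrite divr_gt0// ltr_pwDl.
have /cvgrPdist_lt/(_ _ e1)/near_norm_lt[r r0 Hr] := @cv xi y.
pose e := Num.min r (e' / (1 + c)).
have e0 : 0 < e by rewrite lt_min r0 e1.
have [xh Hmax] := cone_touching y L0 e0 xiI.
have xh_e : `|xh - y| < e.
  rewrite ltNge; apply/negP => /(grad_cone L0 e0) gL.
  have /(coF xh _ _ xiI) := gL; apply/negP; rewrite -leNgt.
  have := vsub (C1_cone L y e0) xiI (near_all xh Hmax).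
  have := K_ub I1 mk k0_gt0 kb xiI (iv xh) (v_le xh).
  have := f_le xh xiI; have /andP[kk kk'] := kapP xiI.
  have : kap xi * B <= k1 * B by rewrite ler_wpM2r.
  have : 0 <= (alpha + kap xi) * v xh xi.
    by rewrite mulr_ge0 ?v_ge0//; move: alpha_gt0 k0_gt0; lra.
  lra.
have /Hr : `|xh - y| < r by apply: lt_le_trans xh_e _; rewrite ge_min lexx.
rewrite ltr_norml => /andP[h1 h2].
have h3 := Hmax x; have h4 := cone_ge0 e y L0 xh; have h5 := cone_le y L0 e0 x.
have h6 : e <= e' / (1 + c) by rewrite ge_min lexx orbT.
have h7 : c * e <= c * (e' / (1 + c)) by rewrite ler_wpM2l.
have h8 : (1 + c) * (e' / (1 + c)) = e' by rewrite mulrC divfK// gt_eqF// ltr_pwDl.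
rewrite -/c in h5 *; lra.
Qed.

End Subsolution.
(** The penalty depends only on [x - y], so a common lattice shift brings [x] into the unit ball;
    the penalty then confines [y], and compactness applies. *)
Lemma doubling_max (u w : V -> R) (c B : R) : 0 < c -> 0 <= B ->
  continuous u -> continuous w -> Defs.periodic u -> Defs.periodic w ->
  (forall x, 0 <= u x <= B) -> (forall x, 0 <= w x <= B) ->
  exists xh yh, forall x y,
    u x - w y - paraboloid c y x <= u xh - w yh - paraboloid c yh xh.
Proof.
move=> c0 B0 cu cw pu pw uB wB.
(* If [x] is in the unit ball and [y] is beyond [rho], the penalty is at least [2 * B], so the value
   does not exceed the one at [(0, 0)]. *)
pose rho := 2 + 2 * B / c.
pose g (z : V * V) := u z.1 - w z.2 - paraboloid c z.2 z.1.
have cg : continuous g.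
  move=> z; have c1 : u z'.1 @[z' --> z] --> u z.1 by apply: (cvg_comp fst u cvg_fst (cu z.1)).
  have c2 : w z'.2 @[z' --> z] --> w z.2 by apply: (cvg_comp snd w cvg_snd (cw z.2)).
  have c4 : (z'.1 - z'.2) @[z' --> z] --> z.1 - z.2 by exact: (cvgB cvg_fst cvg_snd).
  have c3 : paraboloid c z'.2 z'.1 @[z' --> z] --> paraboloid c z.2 z.1.
    have pE (y x : V) : paraboloid c y x = paraboloid c 0 (x - y).
      by apply: eq_bigr => j _; rewrite !mxE subr0.
    rewrite pE; under eq_cvg do rewrite pE.
    exact: (cvg_comp _ _ c4 (C1_continuous (C1_paraboloid c 0) (x := z.1 - z.2))).
  exact: (cvgB (cvgB c1 c2) c3).
have K0 : cball (0 : V) 1 `*` cball (0 : V) rho !=set0.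
  exists (0, 0); split; rewrite /cball /= subrr normr0// /rho.
  by rewrite addr_ge0// divr_ge0 ?mulr_ge0// ltW.
have [[xh yh] _ H] := compact_EVT_max K0
  (compact_setX (@compact_cball _ _ 0 1) (@compact_cball _ _ 0 rho)) (continuous_subspaceT cg).
have {}H x y : `|x| <= 1 -> `|y| <= rho -> g (x, y) <= g (xh, yh).
  by move=> x1 y1; apply: H; apply/mem_set; split; rewrite /cball /= subr0.
exists xh, yh => x y; rewrite -[leRHS]/(g (xh, yh)).
have [z [Hz xz]] := periodic_shift x.
have -> : u x - w y - paraboloid c y x = g (x - z, y - z).
  rewrite /g /= (Hz _ _ pu) (Hz _ _ pw); congr (_ - _).
  by apply: eq_bigr => j _; rewrite !mxE; congr (c * _ ^+ 2); ring.
have [yr|yr] := leP (`|y - z|) rho; first exact: H.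
have : g (0, 0) <= g (xh, yh).
  by apply: H; rewrite normr0// addr_ge0// divr_ge0 ?mulr_ge0// ltW.
apply: le_trans; rewrite /g /= paraboloid_center subr0.
have h1 := le_paraboloid (y - z) (x - z) (ltW c0).
have h2 : 1 + 2 * B / c <= `|x - z - (y - z)|.
  have := ler_normB (x - z) (x - z - (y - z)); rewrite subKr.
  by move: yr; rewrite /rho; lra.
have Bc : 0 <= 2 * B / c by rewrite divr_ge0 ?mulr_ge0// ltW.
have h3 : 2 * B <= c * `|x - z - (y - z)| ^+ 2.
  have -> : 2 * B = c * (2 * B / c) by rewrite [RHS]mulrC divfK// gt_eqF.
  rewrite ler_wpM2l ?(ltW c0)//; nra.
have /andP[? ?] := uB (x - z); have /andP[? ?] := wB (y - z).
have /andP[? ?] := uB 0; have /andP[? ?] := wB 0; lra.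
Qed.

(** * The comparison principle *)

Section Comparison.
Variables (beta B Lip : R) (u w : V -> R -> R).
Hypothesis beta_gt0 : 0 < beta.
Hypothesis Lip_ge0 : 0 <= Lip.
Hypothesis f_unif : forall e : R, 0 < e -> exists2 t, 0 < t &
  forall x y xi, xi \in I -> `|x - y| < t -> `|f x xi - f y xi| <= e.
Hypothesis F_unif : forall Rad e : R, 0 < Rad -> 0 < e -> exists2 t, 0 < t &
  forall x y p xi, xi \in I -> `|x - y| < t -> `|p| <= Rad ->
    `|F x p xi - F y p xi| <= e.
Hypothesis cu : forall xi, continuous (u ^~ xi).
Hypothesis cw : forall xi, continuous (w ^~ xi).
Hypothesis pu : forall xi, Defs.periodic (u ^~ xi).
Hypothesis pw : forall xi, Defs.periodic (w ^~ xi).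
Hypothesis iu : forall x, integ (u x).
Hypothesis iw : forall x, integ (w x).
Hypothesis uB : forall x xi, xi \in I -> 0 <= u x xi <= B.
Hypothesis wB : forall x xi, xi \in I -> 0 <= w x xi <= B.
Hypothesis u_lip : forall x y xi, xi \in I -> u x xi - u y xi <= Lip * `|x - y|.
Hypothesis usub : test_sub beta u.
Hypothesis wsup : test_super beta w.

(** Variables are doubled in [x] only, with the same [xi] on both sides. A nearly optimal [eta]
    makes the coupling terms cancel up to [gam], and the Lipschitz bound on [u] keeps the penalty
    gradients bounded, so [F_unif] applies. *)
Lemma comparison x xi : xi \in I -> u x xi <= w x xi.
Proof.
move=> xiI; rewrite leNgt; apply/negP => lt.
pose s := u x xi - w x xi; have s0 : 0 < s by rewrite subr_gt0.
have k1_gt0 : 0 < k1 by have := kb xiI xiI; move: k0_gt0; lra.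
(* The final estimate is [beta * s <= A * gam], with [gam] from each of [F] and [f], [k1 * gam] from
   the coupling and [beta * gam] from [D]; [gam] makes the right side [beta * s / 2]. *)
pose A := 2 + k1 + beta.
have A0 : 0 < A by rewrite /A; move: beta_gt0; lra.
pose gam := beta * s / (2 * A).
have gam0 : 0 < gam by rewrite divr_gt0 ?mulr_gt0.
have [tf tf0 Hf] := f_unif gam0.
have rad0 : 0 < 2 * Lip + 1 by move: Lip_ge0; lra.
have [tF tF0 HF] := F_unif rad0 gam0.
have B0 : 0 <= B by have := uB x xiI; lra.
pose t := Num.min tf tF; have t0 : 0 < t by rewrite lt_min tf0.
(* Chosen so that [cz] below forces the two points within distance [t] of each other. *)
pose c := (Lip + 1) / t.
have c0 : 0 < c by rewrite divr_gt0//; move: Lip_ge0; lra.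
have ct : c * t = Lip + 1 by rewrite divfK// gt_eqF.
pose E := [set a | exists x, exists y, exists2 eta, eta \in I &
  a = u x eta - w y eta - paraboloid c y x].
have q0 (y z : V) : 0 <= paraboloid c y z.
  by apply: le_trans (le_paraboloid y z (ltW c0)); rewrite mulr_ge0 ?(ltW c0)// sqr_ge0.
have hs : has_sup E.
  split; first by exists (u x xi - w x xi - paraboloid c x x), x, x, xi.
  exists B => _ [y [z [eta etaI ->]]].
  by have := uB y etaI; have := wB z etaI; have := q0 z y; lra.
have [_ [x1 [y1 [eta etaI ->]]] close] := sup_adherent gam0 hs.
have Eub (y z : V) zeta : zeta \in I -> u y zeta - w z zeta - paraboloid c z y <= sup E.
  by move=> zI; apply: sup_upper_bound => //; exists y, z, zeta.
have [xh [yh Hmax]] := doubling_max c0 B0 (@cu eta) (@cw eta) (@pu eta) (@pw eta)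
  (fun z => uB z etaI) (fun z => wB z etaI).
pose D := u xh eta - w yh eta.
have Ds : s - gam <= D.
  have := Eub x x _ xiI; rewrite paraboloid_center; have := Hmax x1 y1.
  by have := q0 yh xh; rewrite /D /s; lra.
have gap zeta : zeta \in I -> u xh zeta - w yh zeta <= D + gam.
  by move=> zI; have := Eub xh yh _ zI; have := Hmax x1 y1; rewrite /D; lra.
(* Comparing the maximum with the pair [(yh, yh)] bounds the penalty by the increment of [u]. *)
have cz : c * `|xh - yh| <= Lip.
  have [z0|z0] := leP (`|xh - yh|) 0.
    by apply: le_trans Lip_ge0; rewrite mulr_ge0_le0// ltW.
  rewrite -(ler_pM2r z0) -mulrA -expr2.
  apply: le_trans (le_paraboloid yh xh (ltW c0)) _.
  have := Hmax yh yh; rewrite paraboloid_center; have := u_lip xh yh etaI; lra.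
have zt : `|xh - yh| < t.
  by rewrite -(ltr_pM2l c0) ct; apply: le_lt_trans cz _; rewrite ltrDl.
have p1 : `|(2 * c) *: (xh - yh)| <= 2 * Lip + 1.
  have c2 : 0 <= 2 * c by apply: mulr_ge0 => //; exact: ltW.
  rewrite normrZ (ger0_norm c2) -mulrA.
  by apply: (@le_trans _ _ (2 * Lip)); [rewrite ler_wpM2l | rewrite lerDl].
have h1 : (beta + kap eta) * u xh eta + F xh ((2 * c) *: (xh - yh)) eta <=
    f xh eta + K eta (u xh).
  rewrite -grad_paraboloid; apply: usub => //; first exact: C1_paraboloid.
  by apply: near_all => y; have := Hmax y yh; lra.
(* As a function of its centre the penalty is again a paraboloid; its negative touches [w] from
   below with the same gradient as in [h1]. *)
have h2 : f yh eta + K eta (w yh) <=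
    (beta + kap eta) * w yh eta + F yh ((2 * c) *: (xh - yh)) eta.
  rewrite (_ : (2 * c) *: (xh - yh) = grad (paraboloid (- c) xh) yh); last first.
    by rewrite grad_paraboloid mulrN scaleNr -scalerN opprB.
  apply: wsup => //; first exact: C1_paraboloid.
  apply: near_all => y; have := Hmax xh y.
  by rewrite !paraboloidN !(paraboloid_sym _ xh); lra.
have h3 : `|F xh ((2 * c) *: (xh - yh)) eta - F yh ((2 * c) *: (xh - yh)) eta| <= gam.
  by apply: HF => //; apply: lt_le_trans zt _; rewrite ge_min lexx orbT.
have h4 : `|f xh eta - f yh eta| <= gam.
  by apply: Hf => //; apply: lt_le_trans zt _; rewrite ge_min lexx.
have h5 : K eta (u xh) - K eta (w yh) <= kap eta * (D + gam).
  rewrite -(KB mk k0_gt0 kb etaI (iu xh) (iw yh)).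
  apply: (K_ub I1 mk k0_gt0 kb etaI) gap.
  by have := integrableB mI (iu xh) (iw yh).
have /andP[kk kk'] := kapP etaI.
move: h3 h4; rewrite !ler_norml => /andP[h3 _] /andP[_ h4].
have h6 : beta * D <= 2 * gam + kap eta * gam by rewrite /D in h5 *; lra.
have h7 : kap eta * gam <= k1 * gam by rewrite ler_wpM2r// ltW.
have h8 : beta * (s - gam) <= beta * D by rewrite ler_wpM2l// ltW.
have h9 : gam * (2 * A) = beta * s by rewrite divfK// gt_eqF// mulr_gt0.
have h10 : 0 < beta * s by rewrite mulr_gt0.
rewrite /A in h9; lra.
Qed.

End Comparison.
End Estimates.

(** * Stability *)

Section Stability.
Context {R : realType} {d : nat}.
Notation V := 'rV[R]_d.
Variables (I : interval R) (k : R -> R -> R) (k0 k1 : R).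
Notation mu := (@lebesgue_measure R).
Hypothesis I1 : mu (Iset I) = 1%:E.
Hypothesis mk : measurable_fun (Iset I `*` Iset I) (fun z : R * R => k z.1 z.2).
Hypothesis k0_gt0 : 0 < k0.
Hypothesis kb : forall xi eta, xi \in I -> eta \in I -> k0 <= k xi eta <= k1.
Notation kap := (kap I k).
Notation K := (K I k).
Variables (F : V -> V -> R -> R) (f : V -> R -> R).
Hypothesis cF : forall xi, continuous (fun z : V * V => F z.1 z.2 xi).
Hypothesis cf : forall xi, continuous (f ^~ xi).
Variables (a : nat -> R) (B : R) (u : nat -> V -> R -> R) (v : V -> R -> R).
Hypothesis a_cvg : a n @[n --> \oo] --> (0 : R).
Hypothesis cu : forall n xi, continuous (u n ^~ xi).
Hypothesis mu_ : forall n x, measurable_fun (Iset I) (u n x).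
Hypothesis uB : forall n x xi, xi \in I -> 0 <= u n x xi <= B.
Hypothesis cv : forall xi, continuous (v ^~ xi).
Hypothesis uv : forall xi (e : R), xi \in I -> 0 < e ->
  exists N, forall n, (N <= n)%N -> forall x, `|u n x xi - v x xi| < e.

Let equation_residual b (w : V -> R -> R) psi x xi :=
  (b + kap xi) * w x xi + F x (grad psi x) xi - (f x xi + K xi (w x)).

(** [j <= nn j] sends the indices to infinity, and the common bound [B] lets [K] pass to the limit
    by dominated convergence. The sign of the residual then passes to the limit in both viscosity
    inequalities. *)
Let residual_cvg (nn : nat -> nat) (xs : nat -> V) xh psi xi :
  (forall j, (j <= nn j)%N) -> (forall j, `|xs j - xh| < j.+1%:R^-1) ->
  C1 psi -> xi \in I ->
  equation_residual (a (nn j)) (u (nn j)) psi (xs j) xi @[j --> \oo] -->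
  equation_residual 0 v psi xh xi.
Proof.
move=> nnj xsj [_ cpsi] xiI.
have cn : nn j @[j --> \oo] --> \oo.
  move=> A [N _ HA]; exists N => //= j Nj; apply: HA => /=.
  exact: leq_trans Nj (nnj j).
have cx : xs j @[j --> \oo] --> xh.
  apply/cvgrPdist_lt => r r0; near=> j.
  rewrite distrC; apply: lt_trans (xsj j) _.
  near: j; exact: near_infty_natSinv_lt (PosNum r0).
have cuv eta : eta \in I -> u (nn j) (xs j) eta @[j --> \oo] --> v xh eta.
  move=> etaI; have cvx := cvg_comp _ _ cx (@cv eta xh).
  have c0 : u (nn j) (xs j) eta - v (xs j) eta @[j --> \oo] --> (0 : R).
    apply/cvgr0Pnorm_lt => e e0; have [N HN] := uv etaI e0.
    by exists N => //= j Nj; apply: HN; exact: leq_trans Nj (nnj j).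
  have -> : (fun j => u (nn j) (xs j) eta) =
      (fun j => u (nn j) (xs j) eta - v (xs j) eta + v (xs j) eta).
    by apply/funext => j; rewrite subrK.
  by rewrite -[v xh eta]add0r; exact: (cvgD c0 cvx).
have ca : a (nn j) @[j --> \oo] --> (0 : R) by exact: (cvg_comp _ _ cn a_cvg).
have cK : K xi (u (nn j) (xs j)) @[j --> \oo] --> K xi (v xh).
  apply: (Rintegral_bounded_cvg (mu := mu) (measurable_I I) (c := k1 * B)) => //.
  - exact: measure_I_fin.
  - by move=> j; apply: measurable_realfun.measurable_funM; [exact: (measurable_k mk)|exact: mu_].
  - move=> j eta etaI; rewrite normrM ler_pM//.
      exact: (k_norm_le k0_gt0 kb).
    by have /andP[h0 hB] := uB (nn j) (xs j) etaI; rewrite ger0_norm.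
  - by move=> eta etaI; exact: (cvgM (cvg_cst _) (cuv eta etaI)).
have cG : F (xs j) (grad psi (xs j)) xi @[j --> \oo] --> F xh (grad psi xh) xi.
  have cp : (xs j, grad psi (xs j)) @[j --> \oo] --> (xh, grad psi xh).
    exact: (cvg_pair cx (cvg_comp _ _ cx (cpsi xh))).
  exact: (cvg_comp _ _ cp (@cF xi (xh, grad psi xh))).
exact: (cvgB (cvgD (cvgM (cvgD ca (cvg_cst _)) (cuv xi xiI)) cG)
  (cvgD (cvg_comp _ _ cx (@cf xi xh)) cK)).
Unshelve. all: by end_near. Qed.

(** The paraboloid is critical at its centre, so making the contact strict leaves the gradient at
    [x] unchanged. *)
Let grad_perturbed c (phi : V -> R) x : C1 phi ->
  grad (fun y => phi y + paraboloid c x y) x = grad phi x.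
Proof.
move=> [dphi _]; have [dq _] := C1_paraboloid c x.
by rewrite gradD// grad_paraboloid subrr scaler0 addr0.
Qed.

Lemma test_sub_limit : (forall n, test_sub I k F f (a n) (u n)) ->
  test_sub I k F f 0 v.
Proof.
move=> subu phi xi xh Cphi xiI Hmax.
pose psi y := phi y + paraboloid 1 xh y.
have Cpsi : C1 psi by exact: C1D Cphi (C1_paraboloid 1 xh).
have H j : exists nx : nat * V, [/\ (j <= nx.1)%N, `|nx.2 - xh| < j.+1%:R^-1 &
    \forall y \near nx.2, u nx.1 y xi - psi y <= u nx.1 nx.2 xi - psi nx.2].
  have r0 : (0 : R) < j.+1%:R^-1 by rewrite invr_gt0.
  have [e e0 He] := touching_stable r0 (@cv xi) (C1_continuous Cphi) Hmax.
  have [N HN] := uv xiI e0.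
  (* The index [maxn j N] ensures both the uniform closeness required by [touching_stable] and
     divergence with [j]. *)
  have [x xr Hx] := He (u (maxn j N) ^~ xi) (@cu _ xi) (HN _ (leq_maxr j N)).
  by exists (maxn j N, x); split => //=; exact: leq_maxl.
have [nx Hnx] := choice H.
have := @residual_cvg (fun j => (nx j).1) (fun j => (nx j).2) xh psi xi
  (fun j => let: And3 p _ _ := Hnx j in p) (fun j => let: And3 _ p _ := Hnx j in p) Cpsi xiI.
rewrite {2}/equation_residual grad_perturbed// => cvg_res.
rewrite -subr_le0; apply: (cvgr_to_le cvg_res).
apply: nearW => j; rewrite /equation_residual subr_le0.
by case: (Hnx j) => _ _ /(subu _ _ _ _ Cpsi xiI).
Qed.

Lemma test_super_limit : (forall n, test_super I k F f (a n) (u n)) ->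
  test_super I k F f 0 v.
Proof.
move=> supu phi xi xh Cphi xiI Hmin.
pose psi y := phi y + paraboloid (- 1) xh y.
have Cpsi : C1 psi by exact: C1D Cphi (C1_paraboloid (- 1) xh).
have H j : exists nx : nat * V, [/\ (j <= nx.1)%N, `|nx.2 - xh| < j.+1%:R^-1 &
    \forall y \near nx.2, u nx.1 nx.2 xi - psi nx.2 <= u nx.1 y xi - psi y].
  have r0 : (0 : R) < j.+1%:R^-1 by rewrite invr_gt0.
  have cN (w : V -> R) : continuous w -> continuous (fun y => - w y).
    by move=> cw y; exact: (cvgN (cw y)).
  (* Minima become maxima of the negated functions, so [touching_stable] applies again. *)
  have Hmax : \forall y \near xh, - v y xi - (- phi y) <= - v xh xi - (- phi xh).
    by move: Hmin; apply: filterS => y; lra.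
  have [e e0 He] := touching_stable r0 (cN _ (@cv xi)) (cN _ (C1_continuous Cphi)) Hmax.
  have [N HN] := uv xiI e0.
  have [|x xr Hx] := He (fun y => - u (maxn j N) y xi) (cN _ (@cu _ xi)).
    by move=> y; rewrite -opprD normrN; exact: HN (leq_maxr j N) y.
  exists (maxn j N, x); split => //=; first exact: leq_maxl.
  by move: Hx; apply: filterS => y; rewrite /psi !paraboloidN; lra.
have [nx Hnx] := choice H.
have := @residual_cvg (fun j => (nx j).1) (fun j => (nx j).2) xh psi xi
  (fun j => let: And3 p _ _ := Hnx j in p) (fun j => let: And3 _ p _ := Hnx j in p) Cpsi xiI.
rewrite {2}/equation_residual grad_perturbed// => cvg_res.
rewrite -subr_ge0; apply: (cvgr_to_ge cvg_res).
apply: nearW => j; rewrite /equation_residual subr_ge0.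
by case: (Hnx j) => _ _ /(supu _ _ _ _ Cpsi xiI).
Qed.

End Stability.

(** * The vanishing discount limit *)

Section DiscountedLimit.
Context {R : realType} {d : nat}.
Notation V := 'rV[R]_d.
Variables (I : interval R) (k : R -> R -> R) (k0 k1 : R).
Notation mu := (@lebesgue_measure R).
Hypothesis I1 : mu (Iset I) = 1%:E.
Hypothesis mk : measurable_fun (Iset I `*` Iset I) (fun z : R * R => k z.1 z.2).
Hypothesis k0_gt0 : 0 < k0.
Hypothesis kb : forall xi eta, xi \in I -> eta \in I -> k0 <= k xi eta <= k1.
Variables (F : V -> V -> R -> R) (f : V -> R -> R).
Hypothesis cF : forall xi, continuous (fun z : V * V => F z.1 z.2 xi).
Hypothesis cf : forall xi, continuous (f ^~ xi).
Variables (B Lip : R) (va : R -> V -> R -> R).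
Hypothesis Lip_ge0 : 0 <= Lip.
Hypothesis CBva : forall a, 0 < a -> CB I (va a).
Hypothesis vaB : forall a x xi, 0 < a -> xi \in I -> 0 <= va a x xi <= B.
Hypothesis va_lip : forall a x y xi, 0 < a -> xi \in I ->
  va a x xi - va a y xi <= Lip * `|x - y|.
Hypothesis va_mono : forall a b x xi, 0 < a -> a <= b -> xi \in I ->
  va b x xi <= va a x xi.
Hypothesis va_sub : forall a, 0 < a -> test_sub I k F f a (va a).
Hypothesis va_super : forall a, 0 < a -> test_super I k F f a (va a).

Let an (n : nat) : R := n.+1%:R^-1.
Let an_gt0 n : 0 < an n. Proof. by rewrite invr_gt0. Qed.
Let an_le m n : (m <= n)%N -> an n <= an m.
Proof. by move=> mn; rewrite lef_pV2 ?posrE// ler_nat. Qed.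
Let u n := va (an n).

(** [CB] asks for continuity and periodicity at every real [xi], hence the value 0 outside [I],
    where convergence is not known. *)
Let v x xi : R := if xi \in I then limn (fun n => u n x xi) else 0.

Let u_cvg x xi : xi \in I -> u n x xi @[n --> \oo] --> v x xi.
Proof.
move=> xiI; rewrite /v xiI; apply: nondecreasing_is_cvgn.
  by move=> m n mn; apply: va_mono => //; exact: an_le.
exists B => _ [n _ <-]; by have /andP[] := vaB x (an_gt0 n) xiI.
Qed.

Let va_le_v a x xi : 0 < a -> xi \in I -> va a x xi <= v x xi.
Proof.
move=> a0 xiI; apply: (cvgr_to_ge (@u_cvg x xi xiI)).
near=> n; apply: va_mono => //; apply: ltW.
by near: n; exact: near_infty_natSinv_lt (PosNum a0).
Unshelve. all: by end_near. Qed.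

Let v_le x xi : xi \in I -> v x xi <= B.
Proof.
move=> xiI; apply: (cvgr_to_le (@u_cvg x xi xiI)); apply: nearW => n.
by have /andP[] := vaB x (an_gt0 n) xiI.
Qed.

Let v_ge0 x xi : xi \in I -> 0 <= v x xi.
Proof.
move=> xiI; apply: le_trans (va_le_v x (an_gt0 0) xiI).
by have /andP[] := vaB x (an_gt0 0) xiI.
Qed.

Let v_lip x y xi : xi \in I -> `|v x xi - v y xi| <= Lip * `|x - y|.
Proof.
move=> xiI.
have H z t : v z xi - v t xi <= Lip * `|z - t|.
  apply: (cvgr_to_le (cvgB (@u_cvg z xi xiI) (@u_cvg t xi xiI))); apply: nearW => n.
  exact: va_lip.
by rewrite ler_norml lerNl opprB {1}distrC !H.
Qed.

Let lipschitz_continuous (g : V -> R) :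
  (forall x y, `|g x - g y| <= Lip * `|x - y|) -> continuous g.
Proof.
move=> gl x; apply/(@cvgrPdist_lt _ _ _ (nbhs x) _) => e e0.
(* [Lip] may be 0, so [Lip + 1] is used as the divisor. *)
have L1 : 0 < Lip + 1 by rewrite ltr_wpDl.
apply/near_norm_lt; exists (e / (Lip + 1)); first by rewrite divr_gt0.
move=> y yx; apply: le_lt_trans (gl x y) _.
rewrite distrC; move: yx; rewrite ltr_pdivlMr//; have := normr_ge0 (y - x); lra.
Qed.

Let cv xi : continuous (v ^~ xi).
Proof.
have [xiI|xiI] := boolP (xi \in I).
  by apply: lipschitz_continuous => x y; exact: v_lip.
rewrite (_ : v ^~ xi = fun=> 0); first by exact: cst_continuous.
by apply/funext => x; rewrite /v (negbTE xiI).
Qed.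

Let pv xi : Defs.periodic (v ^~ xi).
Proof.
move=> x j; rewrite /v; case: ifP => // xiI; congr (limn _); apply/funext => n.
by case: (CBva (an_gt0 n)) => /(_ xi)[p _] _; exact: p.
Qed.

Let mv x : measurable_fun (Iset I) (v x).
Proof.
apply: (@measurable_realfun.measurable_fun_cvg _ _ _ _ (fun n => u n x)).
  by move=> n; case: (CBva (an_gt0 n)) => _; exact.
by move=> xi xiI; exact: u_cvg.
Qed.

(* Dini: monotone pointwise convergence of equi-Lipschitz functions on the
   compact unit ball, which meets every class modulo the lattice. *)
Let uv xi (e : R) : xi \in I -> 0 < e ->
  exists N, forall n, (N <= n)%N -> forall x, `|u n x xi - v x xi| < e.
Proof.
move=> xiI e0.
have [] := proj1 (compact_near_coveringP _) (@compact_cball R d 0 1) nat \oo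
  (fun n x => `|u n x xi - v x xi| < e) _.
  move=> x _; have e3 : 0 < e / 3 by rewrite divr_gt0.
  have L1 : 0 < Lip + 1 by rewrite ltr_wpDl.
  have r0 : 0 < e / 3 / (Lip + 1) by rewrite divr_gt0.
  have h1 : \forall y \near x, Lip * `|x - y| < e / 3.
    apply/near_norm_lt; exists (e / 3 / (Lip + 1)) => // y.
    rewrite distrC ltr_pdivlMr//; have := normr_ge0 (x - y); lra.
  have h2 : \forall n \near \oo, `|v x xi - u n x xi| < e / 3.
    by have /cvgrPdist_lt/(_ _ e3) := @u_cvg x xi xiI.
  near=> y n => /=.
  have h3 : Lip * `|x - y| < e / 3 by near: y.
  have h4 : `|v x xi - u n x xi| < e / 3 by near: n.
  have h5 := v_lip x y xiI.
  have h6 := va_lip x y (an_gt0 n) xiI; have h7 := va_lip y x (an_gt0 n) xiI.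
  rewrite (distrC y x) in h7.
  move: h4 h5; rewrite !ltr_norml !ler_norml => /andP[h8 h9] /andP[h10 h11].
  rewrite /u in h8 h9 *.
  apply/andP; split; lra.
move=> N _ HN; exists N => n Nn x.
have [z [Hz xz]] := periodic_shift x.
rewrite -(Hz _ _ (@pv xi) x) -(Hz _ (u n ^~ xi) _ x); last first.
  by case: (CBva (an_gt0 n)) => /(_ xi)[].
by apply: (HN n Nn); rewrite /cball /= subr0.
Unshelve. all: by end_near. Qed.

Let an_cvg : an n @[n --> \oo] --> (0 : R).
Proof. exact: cvg_harmonic. Qed.

Let cu n xi : continuous (u n ^~ xi).
Proof. by case: (CBva (an_gt0 n)) => /(_ xi)[]. Qed.

Let Uplus_v : Uplus I v /\ Uminus I v.
Proof.
have iv x : mu.-integrable (Iset I) (EFin \o v x).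
  apply: (integrable_bounded (measurable_I I) (c := B) (measure_I_fin I1)).
    exact: mv.
  by move=> xi xiI; rewrite ger0_norm ?v_ge0// v_le.
split; split.
- by move=> x; split; [exact: mv | exact: iv].
- split; first exact: pv.
  move=> xi xiI x e e0; have /cvgrPdist_lt/(_ _ e0) := @cv xi x.
  by apply: filterS => y; rewrite ltr_norml; lra.
- move=> x; split.
    by apply: measurableT_comp => //; exact: mv.
  by have := integrableN (iv x).
- split; first by move=> xi x j; rewrite pv.
  move=> xi xiI x e e0; have /cvgrPdist_lt/(_ _ e0) := @cv xi x.
  by apply: filterS => y; rewrite ltr_norml; lra.
Qed.

Lemma discounted_limit : exists v : V -> R -> R,
  CB I v /\ visc_sol I k 0 F f v /\
  forall xi, xi \in I -> forall e : R, 0 < e -> exists2 delta : R, 0 < delta &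
    forall a, 0 < a < delta -> forall x, `|va a x xi - v x xi| < e.
Proof.
exists v; split; first by split.
have mu_ n x : measurable_fun (Iset I) (u n x) by case: (CBva (an_gt0 n)) => _; exact.
have uB n x xi (xiI : xi \in I) : 0 <= u n x xi <= B by exact: vaB.
have iv x : mu.-integrable (Iset I) (EFin \o v x) by case: Uplus_v => -[/(_ x)[]].
split; last first.
  move=> xi xiI e e0; have [N HN] := uv xiI e0.
  (* Monotonicity extends the convergence from the sequence to all discounts: for [a < an N], [va a]
     lies between [u N] and [v]. *)
  exists (an N) => // a /andP[a0 aN] x.
  have := HN N (leqnn N) x; rewrite !ltr_norml => /andP[h1 h2].
  have h3 := va_le_v x a0 xiI; have h4 := va_mono x a0 (ltW aN) xiI.
  by rewrite /u in h1 h2; apply/andP; split; lra.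
case: Uplus_v => Up Um; split; split => // phi xi xh Cphi xiI H;
  rewrite (couplingE I1 mk k0_gt0 kb)// mul0r add0r.
  have := test_sub_limit I1 mk k0_gt0 kb cF cf an_cvg cu mu_ uB (@cv) uv
    (fun n => va_sub (an_gt0 n)) Cphi xiI H.
  by rewrite add0r; lra.
have := test_super_limit I1 mk k0_gt0 kb cF cf an_cvg cu mu_ uB (@cv) uv
  (fun n => va_super (an_gt0 n)) Cphi xiI H.
by rewrite add0r; lra.
Qed.

End DiscountedLimit.

(** * Moduli, coercivity and the proof of the theorem *)

Lemma modulus_small (R : realType) (w : R -> R) (e : R) : modulus w -> 0 < e ->
  exists2 t, 0 < t & forall r, 0 <= r < t -> w r <= e.
Proof.
move=> [w0 [_ [_ wc]]] e0.
have /cvgr0Pnorm_lt/(_ _ e0) := wc.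
move=> [t /= t0 Ht]; exists t => // r /andP[r0 rt].
(* The right limit at 0 excludes [r = 0], where [w 0 = 0] is used. *)
move: r0; rewrite le_eqVlt => /predU1P[<-|r0]; first by rewrite w0 ltW.
have := Ht r; rewrite /= sub0r normrN gtr0_norm// => /(_ rt r0).
by move=> /(le_lt_trans (ler_norm _))/ltW.
Qed.

(** For [p] of norm at least 1 the power [m > 1] dominates the norm itself, so linear growth already
    passes any level [T]. *)
Lemma superlinear_coercive (R : realType) (d : nat) (I : interval R)
    (F : 'rV[R]_d -> 'rV[R]_d -> R -> R) (c C m T : R) :
  0 < c -> 1 < m ->
  (forall x p xi, xi \in I -> c * `|p| `^ m - C <= F x p xi) ->
  exists2 L, 0 < L & forall x p xi, xi \in I -> L <= `|p| -> T < F x p xi.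
Proof.
move=> c0 m1 HF; pose L := Num.max 1 ((`|T| + C + 1) / c).
exists L; first by rewrite lt_max ltr01.
move=> x p xi xiI; rewrite ge_max => /andP[p1]; rewrite ler_pdivrMr// => pc.
have pm : `|p| <= `|p| `^ m by rewrite -{1}(powRr1 (normr_ge0 p)) ler_powR// ltW.
have := HF x p xi xiI; have := ler_norm T.
have : c * `|p| <= c * `|p| `^ m by rewrite ler_wpM2l// ltW.
lra.
Qed.

Theorem theorem1 (R : realType) (d : nat) (I : interval R)
  (k : R -> R -> R) (k0 k1 : R)
  (F : 'rV[R]_d -> 'rV[R]_d -> R -> R) (f : 'rV[R]_d -> R -> R)
  (va : R -> 'rV[R]_d -> R -> R) :
  (@lebesgue_measure R) (Iset I) = 1%:E ->
  measurable_fun (Iset I `*` Iset I) (fun z : R * R => k z.1 z.2) ->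
  0 < k0 -> k0 < k1 ->
  (forall xi eta, xi \in I -> eta \in I -> k0 <= k xi eta <= k1) ->
  CB2 I F -> CB I f ->
  (exists M, forall x xi, xi \in I -> `|f x xi| <= M) ->
  (forall p, exists M, forall x xi, xi \in I -> `|F x p xi| <= M) ->
  (* (A1) *)
  (exists C1 C2 m : R, 0 < C1 /\ 0 < C2 /\ 1 < m /\
     forall x p xi, xi \in I -> C1 * `|p| `^ m - C2 <= F x p xi) ->
  (* (A2) *)
  (forall x xi, xi \in I -> 0 <= f x xi) ->
  (exists x, forall xi, xi \in I -> f x xi = 0) ->
  (* (A3) *)
  (forall x xi p q (t : R), xi \in I -> 0 <= t <= 1 ->
     F x (t *: p + (1 - t) *: q) xi <= t * F x p xi + (1 - t) * F x q xi) ->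
  (* (A4) *)
  (forall x p xi, xi \in I -> 0 <= F x p xi) ->
  (forall x xi, xi \in I -> F x 0 xi = 0) ->
  (* (A5) *)
  (exists w, modulus w /\
     forall x y xi, xi \in I -> `|f x xi - f y xi| <= w `|x - y|) ->
  (forall Rad : R, 0 < Rad -> exists w, modulus w /\
     forall x y p q xi, xi \in I -> `|p| <= Rad -> `|q| <= Rad ->
       `|F x p xi - F y q xi| <= w (`|x - y| + `|p - q|)) ->
  (* v^alpha : viscosity solutions of the discounted problems *)
  (forall alpha, 0 < alpha -> CB I (va alpha) /\ visc_sol I k alpha F f (va alpha)) ->
  exists v : 'rV[R]_d -> R -> R,
    CB I v /\ visc_sol I k 0 F f v /\
    forall xi, xi \in I ->
      forall e : R, 0 < e -> exists2 delta : R, 0 < delta &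
        forall alpha, 0 < alpha < delta ->
          forall x, `|va alpha x xi - v x xi| < e.
Proof.
move=> I1 mk k0_gt0 k01 kb [hF mF] [hf mf] [M0 hM0] _ [c1 [c2 [m [c1_gt0 [_ [m1 hA1]]]]]].
move=> f_ge0 [x0 fx0] _ F_ge0 F0 [wf [mod_f f_mod]] F_mod va_sol.
have cf xi : continuous (f ^~ xi) by case: (hf xi).
have cF xi : continuous (fun z : 'rV[R]_d * 'rV[R]_d => F z.1 z.2 xi) by case: (hF xi).
have f_le x xi : xi \in I -> f x xi <= M0.
  by move=> xiI; apply: le_trans (ler_norm _) (hM0 _ _ xiI).
have CBva a : 0 < a -> CB I (va a) by move=> /va_sol[].
have Sva a : 0 < a -> visc_sol I k a F f (va a) by move=> /va_sol[].
have cva a xi : 0 < a -> continuous (va a ^~ xi).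
  by move=> /CBva[/(_ xi)[]].
have pva a xi : 0 < a -> Defs.periodic (va a ^~ xi).
  by move=> /CBva[/(_ xi)[]].
have iva a x : 0 < a -> (@lebesgue_measure R).-integrable (Iset I) (EFin \o va a x).
  by move=> /Sva/sol_integrable; exact.
have va_sub a : 0 < a -> test_sub I k F f a (va a).
  move=> a0 phi xi xh.
  exact: (sol_sub I1 mk k0_gt0 kb (Sva a a0)).
have va_super a : 0 < a -> test_super I k F f a (va a).
  move=> a0 phi xi xh.
  exact: (sol_super I1 mk k0_gt0 kb (Sva a a0)).
have va_ge0 a x xi : 0 < a -> xi \in I -> 0 <= va a x xi.
  move=> a0; exact: (sol_ge0 I1 mk k0_gt0 kb F_ge0 F0 f_ge0 f_le cf a0 (CBva a a0) (Sva a a0)).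
have va_bounded a : 0 < a -> exists C, forall x xi, xi \in I -> va a x xi <= C.
  move=> a0; exact: (sol_bounded I1 mk k0_gt0 kb F_ge0 f_le cf a0 (CBva a a0) (Sva a a0)).
have f_unif (e : R) : 0 < e -> exists2 t, 0 < t &
    forall x y xi, xi \in I -> `|x - y| < t -> `|f x xi - f y xi| <= e.
  move=> e0; have [t t0 Ht] := modulus_small mod_f e0; exists t => // x y xi xiI xyt.
  by apply: le_trans (f_mod x y xi xiI) _; apply: Ht; rewrite normr_ge0.
have F_unif (Rad e : R) : 0 < Rad -> 0 < e -> exists2 t, 0 < t &
    forall x y p xi, xi \in I -> `|x - y| < t -> `|p| <= Rad ->
    `|F x p xi - F y p xi| <= e.
  move=> Rad0 e0; have [w [mod_w Hw]] := F_mod Rad Rad0.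
  have [t t0 Ht] := modulus_small mod_w e0; exists t => // x y p xi xiI xyt pR.
  apply: le_trans (Hw x y p p xi xiI pR pR) _; apply: Ht.
  by rewrite subrr normr0 addr0 normr_ge0.
(* The level [M0 + k1] does not involve the discount, so neither do [L1] and [B]. *)
have [L1 L1_gt0 HL1] := superlinear_coercive (M0 + k1) c1_gt0 m1 hA1.
pose B := 4 * L1 * d%:R + 2.
have va_le a x xi : 0 < a -> xi \in I -> va a x xi <= B.
  move=> a0; have [Ba HBa] := va_bounded a a0.
  (* Within [t] of the zero [x0] of [f] one has [f <= a], hence [va a <= a / a = 1]. The radius
     depends on [a], but the bound [B] does not. *)
  have [t t0 Ht] := f_unif a a0.
  have te : 0 < Num.min t 1 by rewrite lt_min t0 ltr01.
  have te1 : Num.min t 1 <= 1 by rewrite ge_min lexx orbT.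
  apply: (uniform_bound I1 mk k0_gt0 kb f_le a0 (fun xi => cva a xi a0) (fun xi => pva a xi a0)
    (fun x => iva a x a0) (fun x xi => va_ge0 a x xi a0) HBa (va_sub a a0) L1_gt0 te te1 HL1).
  move=> y eta etaI yx; rewrite -(@divff _ a) ?gt_eqF//.
  apply: (sol_le_source I1 mk k0_gt0 kb F_ge0 f_le cf a0 (CBva a a0) (Sva a a0)) => // zeta zI.
  have := Ht y x0 zeta zI (lt_le_trans yx _); rewrite fx0// subr0.
  by rewrite ge_min lexx => /(_ isT); apply: le_trans; exact: ler_norm.
have [L2 L2_gt0 HL2] := superlinear_coercive (M0 + k1 * B) c1_gt0 m1 hA1.
pose Lip := 2 * L2 * d%:R.
have Lip_ge0 : 0 <= Lip by rewrite !mulr_ge0// ltW.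
have va_lip a x y xi : 0 < a -> xi \in I -> va a x xi - va a y xi <= Lip * `|x - y|.
  move=> a0; exact: (lipschitz_bound I1 mk k0_gt0 kb f_le a0 (fun xi => cva a xi a0)
    (fun x => iva a x a0) (fun x xi => va_ge0 a x xi a0) (fun x xi => va_le a x xi a0)
    (va_sub a a0) L2_gt0 HL2).
have vaB a x xi : 0 < a -> xi \in I -> 0 <= va a x xi <= B.
  by move=> a0 xiI; rewrite va_ge0// va_le.
have va_mono a b x xi : 0 < a -> a <= b -> xi \in I -> va b x xi <= va a x xi.
  move=> a0 ab; have b0 := lt_le_trans a0 ab.
  apply: (comparison I1 mk k0_gt0 kb b0 Lip_ge0 f_unif F_unif (fun xi => cva b xi b0)
    (fun xi => cva a xi a0) (fun xi => pva b xi b0) (fun xi => pva a xi a0)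
    (fun x => iva b x b0) (fun x => iva a x a0) (fun x xi => vaB b x xi b0)
    (fun x xi => vaB a x xi a0) (fun x y xi => va_lip b x y xi b0) (va_sub b b0)).
  (* Since [va a >= 0], raising the discount from [a] to [b] keeps the supersolution inequality. *)
  move=> phi eta xh Cphi etaI H.
  apply: le_trans (va_super a a0 phi eta xh Cphi etaI H) _.
  by rewrite lerD2r ler_wpM2r ?va_ge0// lerD2r.
exact: (discounted_limit I1 mk k0_gt0 kb cF cf Lip_ge0 CBva vaB va_lip va_mono va_sub va_super).
Qed.
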